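(* Let $0\le\alpha\in L^1([0,\infty))$, $0\le\sigma\in L^1_{\rm loc}([0,\infty))$, let $\rho_\pm>0$ and $u_\pm$ be constants, and suppose $u_->u_+$. Then the Riemann problem $$\rho_t+\alpha(t)(\rho u)_x=0,\qquad(\rho u)_t+\alpha(t)(\rho u^2)_x=-\sigma(t)\rho u,$$ $$(\rho(x,0),u(x,0))=(\rho_-,u_-)\ \text{ if }x<0,\qquad (\rho_+,u_+)\ \text{ if }x>0,$$ admits, under the entropy condition $$\lambda(\rho_+,u_+)e^{-\int_0^t\sigma(r)dr}<\frac{dx(t)}{dt}<\lambda(\rho_-,u_-)e^{-\int_0^t\sigma(r)dr}\qquad\text{for all }t\ge0,$$ where $\lambda(\rho,u)=\alpha u$ is the eigenvalue associated to the system, a unique delta shock solution of the form $$(\rho(x,t),u(x,t))=\begin{cases}\left(\rho_-,\,u_-e^{-\int_0^t\sigma(r)dr}\right),& x<x(t),\\ \left(w(t)\,\delta(x-x(t)),\,u_\delta(t)\right),& x=x(t),\\ \left(\rho_+,\,u_+e^{-\int_0^t\sigma(r)dr}\right),& x>x(t),\end{cases}$$ where, for $\rho_-\ne\rho_+$, $$w(t)=\sqrt{\rho_-\rho_+}\,(u_--u_+)\int_0^t\alpha(s)e^{-\int_0^s\sigma(r)dr}ds,\qquad u_\delta(t)=\frac{\sqrt{\rho_-}u_-+\sqrt{\rho_+}u_+}{\sqrt{\rho_-}+\sqrt{\rho_+}}e^{-\int_0^t\sigma(r)dr},$$ $$x(t)=\frac{\sqrt{\rho_-}u_-+\sqrt{\rho_+}u_+}{\sqrt{\rho_-}+\sqrt{\rho_+}}\int_0^t\alpha(s)e^{-\int_0^s\sigma(r)dr}ds,$$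 and, for $\rho_-=\rho_+$, $$w(t)=\rho_-(u_--u_+)\int_0^t\alpha(s)e^{-\int_0^s\sigma(r)dr}ds,\qquad u_\delta(t)=\tfrac12(u_-+u_+)e^{-\int_0^t\sigma(r)dr},$$ $$x(t)=\tfrac12(u_-+u_+)\int_0^t\alpha(s)e^{-\int_0^s\sigma(r)dr}ds.$$
   Context: Here $x\in\mathbb{R}$ and $t>0$. Weighted delta function: given $w\in L^1((a,b))$, $-\infty<a<b<\infty$, and a smooth curve $L=\{(x(s),t(s)):a<s<b\}$, $w(\cdot)\delta_L$ is the two-dimensional weighted delta function supported on $L$ when, for each test function $\varphi\in C_0^\infty(\mathbb{R}\times[0,\infty))$, $\langle w(\cdot)\delta_L,\varphi\rangle=\int_a^bw(s)\varphi(x(s),t(s))\,ds$. The entry $w(t)\delta(x-x(t))$ on $x=x(t)$ denotes the singular part $w\delta_L$ of $\rho$, supported on the curve $x=x(t)$. Delta shock (wave) solution: a distribution pair $(\rho,u)$ for which there exist a smooth curve $L$ and a function $w(\cdot)$ such that $\rho=\widehat\rho(x,t)+w\delta_L$ and $u=u(x,t)$, with $\widehat\rho,u\in L^\infty(\mathbb{R}\times(0,\infty))$, $u|_L=u_\delta(t)$, and for each $\varphi\in C_0^\infty(\mathbb{R}\times(0,\infty))$ $$\langle\rho,\varphi_t\rangle+\langle\alpha\rho u,\varphi_x\rangle=0,\qquad\langle\rho u,\varphi_t\rangle+\langle\alpha\rho u^2,\varphi_x\rangle=\langle\sigma\rho u,\varphi\rangle,$$ where $\langle\rho,\varphi\rangle:=\iint_{\mathbb{R}\times(0,\infty)}\widehat\rho\,\varphi\,dx\,dt+\langle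 w\delta_L,\varphi\rangle$ and, for a smooth function $G$, $$\langle\alpha\rho G(\cdot),\varphi\rangle:=\iint_{\mathbb{R}\times(0,\infty)}\alpha(t)\widehat\rho\,G(u)\varphi\,dx\,dt+\langle\alpha(\cdot)wG(u_\delta)\delta_L,\varphi\rangle;$$ $\langle\rho u,\varphi\rangle$ and $\langle\sigma\rho u,\varphi\rangle$ are read in the same way with $\alpha$ replaced by $1$ and by $\sigma$.
   Formalization: The entropy inequality is imposed only at almost every t with α(t)>0; the curve need only be locally absolutely continuous, not smooth; w is unique almost everywhere, u_δ almost everywhere where w≠0; the initial data are distributional limits as t→0+. *)

(* Defs.v *)
From HB Require Import structures.
From mathcomp Require Import all_boot all_order all_algebra.
From mathcomp Require Import all_classical all_reals all_analysis.

Set Implicit Arguments.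
Unset Strict Implicit.
Unset Printing Implicit Defensive.

Import Order.TTheory GRing.Theory Num.Theory.
Import numFieldNormedType.Exports.

Local Open Scope classical_set_scope.
Local Open Scope ring_scope.

(* Functions of (x, t) are curried, space variable first. *)

Definition dx {R : realType} (phi : R -> R -> R) : R -> R -> R :=
  fun x t => derive1 (phi^~ t) x.

Definition dt {R : realType} (phi : R -> R -> R) : R -> R -> R :=
  fun x t => derive1 (phi x) t.

(* Mixed partial derivative along a word: [true] is d/dt, [false] is d/dx. *)
Definition partial {R : realType} (s : seq bool) (phi : R -> R -> R) :
    R -> R -> R :=
  foldr (fun b f => if b then dt f else dx f) phi s.

Definition smooth2 {R : realType} (phi : R -> R -> R) : Prop :=
  forall s : seq bool,
    [/\ continuous (fun p : R * R => partial s phi p.1 p.2),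
        forall x t, derivable ((partial s phi)^~ t) x 1
      & forall x t, derivable (partial s phi x) t 1].

(* C_0^oo(R x (0,oo)), each element being extended by 0 to the plane. *)
Definition test_function {R : realType} (phi : R -> R -> R) : Prop :=
  let supp := closure [set p : R * R | phi p.1 p.2 != 0] in
  [/\ smooth2 phi, compact supp & supp `<=` [set p | 0 < p.2]].

(* C_0^oo(R) *)
Definition test_function1 {R : realType} (psi : R -> R) : Prop :=
  (forall (n : nat) (x : R), derivable (derive1n n psi) x 1) /\
  compact (closure [set x : R | psi x != 0]).

(* f is in L^1((0,T)) for every T, i.e. f is in L^1_loc([0,oo)) *)
Definition L1loc {R : realType} (f : R -> R) : Prop :=
  forall T : R, 0 < T ->
    (@lebesgue_measure R).-integrable `]0, T[ (EFin \o f).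

Definition half_plane {R : realType} : set (R * R) := [set: R] `*` `]0, +oo[.

Definition Linfty {R : realType} (f : R -> R -> R) : Prop :=
  measurable_fun (@half_plane R) (fun p : R * R => f p.1 p.2) /\
  exists M : R,
    {ae (@lebesgue_measure R \x @lebesgue_measure R)%E,
      forall p : R * R, half_plane p -> `|f p.1 p.2| <= M}.

(* The weighted delta function w(.) delta_L for the curve
   L = {(x(s), t(s)) : s in I}, applied to phi. *)
Definition weighted_delta {R : realType} (I : set R) (x t w : R -> R)
    (phi : R -> R -> R) : R :=
  \int[@lebesgue_measure R]_(s in I) (w s * phi (x s) (t s)).

(* <beta rho G(u), phi>, where rho = rhohat + w delta_L, L is the graph
   {(x(t), t) : t > 0} and u = udelta on L. *)
Definition pairing {R : realType} (rhohat u : R -> R -> R)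
    (x w udelta : R -> R) (beta G : R -> R) (phi : R -> R -> R) : R :=
  \int[(@lebesgue_measure R \x @lebesgue_measure R)%E]_(p in half_plane)
    (beta p.2 * rhohat p.1 p.2 * G (u p.1 p.2) * phi p.1 p.2) +
  weighted_delta `]0, +oo[ x id (fun t => beta t * w t * G (udelta t)) phi.

(* The regularity of the curve t |-> x(t): since alpha is only integrable,
   the shock curve x(t) = c * \int_0^t alpha(s) e^{-\int_0^s sigma} ds is in
   general no better than locally absolutely continuous, so "smooth" cannot
   mean C^1.  The curves allowed are the indefinite integrals on [0,oo) of
   L^1_loc functions; every C^1 curve on [0,oo) is one of them. *)
Definition abs_cont_curve {R : realType} (x : R -> R) : Prop :=
  exists2 v : R -> R, L1loc v &
    forall t, 0 <= t ->
      x t = x 0 + \int[@lebesgue_measure R]_(s in `[0, t]) v s.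

(* The five weights below are those of the delta functions occurring in the
   two weak equations; a weighted delta function needs an integrable weight.
   On the unbounded curve this is required on every bounded piece 0 < t < T,
   which is all that a compactly supported test function sees. *)
Definition delta_shock_solution {R : realType} (alpha sigma : R -> R)
    (rhohat u : R -> R -> R) (x w udelta : R -> R) : Prop :=
  let one := fun=> 1 : R in
  let sqr := fun v : R => v ^+ 2 in
  let P := pairing rhohat u x w udelta in
  [/\ Linfty rhohat /\ Linfty u,
      abs_cont_curve x,
      forall t, 0 < t -> u (x t) t = udelta t,
      [/\ L1loc w,
          L1loc (fun t => w t * udelta t),
          L1loc (fun t => alpha t * w t * udelta t),
          L1loc (fun t => alpha t * w t * udelta t ^+ 2)
        & L1loc (fun t => sigma t * w t * udelta t)]
    & forall phi : R -> R -> R, test_function phi ->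
        P one one (dt phi) + P alpha id (dx phi) = 0 /\
        P one id (dt phi) + P alpha sqr (dx phi) = P sigma id phi].

(* The test functions above vanish near t = 0, so the initial data have to be
   imposed separately: rho(., t) and (rho u)(., t), singular parts included,
   converge to rho0 and rho0 u0 in the sense of distributions as t -> 0+. *)
Definition initial_data {R : realType} (rhohat u : R -> R -> R)
    (x w udelta : R -> R) (rho0 u0 : R -> R) : Prop :=
  forall psi : R -> R, test_function1 psi ->
    ((\int[@lebesgue_measure R]_y (rhohat y t * psi y) + w t * psi (x t))
       @[t --> 0^'+] -->
     \int[@lebesgue_measure R]_y (rho0 y * psi y)) /\
    ((\int[@lebesgue_measure R]_y (rhohat y t * u y t * psi y)
        + w t * udelta t * psi (x t))
       @[t --> 0^'+] -->
     \int[@lebesgue_measure R]_y (rho0 y * u0 y * psi y)).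

(* e^{-\int_0^t sigma(r) dr} *)
Definition damping {R : realType} (sigma : R -> R) (t : R) : R :=
  expR (- \int[@lebesgue_measure R]_(r in `[0, t]) sigma r).

(* \int_0^t alpha(s) e^{-\int_0^s sigma(r) dr} ds *)
Definition damped_integral {R : realType} (alpha sigma : R -> R) (t : R) : R :=
  \int[@lebesgue_measure R]_(s in `[0, t]) (alpha s * damping sigma s).

(* The eigenvalue lambda(rho, u) = alpha u, at time t. *)
Definition sys_eigenvalue {R : realType} (alpha : R -> R) (t rho u : R) : R :=
  alpha t * u.

(* As alpha is only an L^1 function, the inequality is imposed at almost every
   t.  Where alpha t = 0 both bounds are 0 and no number lies strictly between
   them, so the inequality is imposed where alpha t > 0, i.e. where the two
   eigenvalues differ; if alpha > 0 a.e. this is no restriction. *)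
Definition entropy_condition {R : realType} (alpha sigma : R -> R)
    (rhom rhop um up : R) (x : R -> R) : Prop :=
  {ae @lebesgue_measure R, forall t, 0 <= t -> 0 < alpha t ->
    derivable x t 1 /\
    sys_eigenvalue alpha t rhop up * damping sigma t < derive1 x t
      < sys_eigenvalue alpha t rhom um * damping sigma t}.

Definition riemann_datum {R : realType} (am ap y : R) : R :=
  if y < 0 then am else ap.

(* The value of the regular part rhohat on the curve is immaterial. *)
Definition shock_rhohat {R : realType} (rhom rhop : R) (x : R -> R) :
    R -> R -> R :=
  fun y t => if y < x t then rhom else rhop.

Definition shock_u {R : realType} (sigma : R -> R) (um up : R)
    (x udelta : R -> R) : R -> R -> R :=
  fun y t => if y < x t then um * damping sigma t
             else if y == x t then udelta t
             else up * damping sigma t.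

(* The delta shock of the prescribed form with curve x, weight w and value
   udelta on the curve is an entropy solution of the Riemann problem. *)
Definition riemann_delta_shock {R : realType} (alpha sigma : R -> R)
    (rhom rhop um up : R) (x w udelta : R -> R) : Prop :=
  let rhohat := shock_rhohat rhom rhop x in
  let u := shock_u sigma um up x udelta in
  [/\ delta_shock_solution alpha sigma rhohat u x w udelta,
      initial_data rhohat u x w udelta
        (riemann_datum rhom rhop) (riemann_datum um up)
    & entropy_condition alpha sigma rhom rhop um up x].

Definition shock_speed {R : realType} (rhom rhop um up : R) : R :=
  if rhom == rhop then (um + up) / 2
  else (Num.sqrt rhom * um + Num.sqrt rhop * up) /
       (Num.sqrt rhom + Num.sqrt rhop).

Definition shock_curve {R : realType} (alpha sigma : R -> R)
    (rhom rhop um up : R) (t : R) : R :=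
  shock_speed rhom rhop um up * damped_integral alpha sigma t.

Definition shock_weight {R : realType} (alpha sigma : R -> R)
    (rhom rhop um up : R) (t : R) : R :=
  (if rhom == rhop then rhom else Num.sqrt (rhom * rhop)) * (um - up) *
  damped_integral alpha sigma t.

Definition shock_udelta {R : realType} (sigma : R -> R)
    (rhom rhop um up : R) (t : R) : R :=
  shock_speed rhom rhop um up * damping sigma t.

(* Main.v *)
Require Import Defs.
From HB Require Import structures.
From mathcomp Require Import all_boot all_order all_algebra.
From mathcomp Require Import all_classical all_reals all_analysis.
From mathcomp Require Import measurable_realfun ring lra.
Import Order.TTheory GRing.Theory Num.Theory.
Import numFieldNormedType.Exports.
Local Open Scope classical_set_scope.
Local Open Scope ring_scope.

(** Notation: [E] is the damping factor, [D t] the integral of [alpha * E] over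
    [[0, t]], [c] the speed and [k] the weight rate of the announced shock, and
    [a = rhop - rhom], [b = rhom um - rhop up], [e = rhom um^2 - rhop up^2].

    As [alpha] and [sigma] are merely integrable, nothing is differentiable
    everywhere; all calculus takes place among indefinite integrals.  Product
    and chain rules ([primitive_chain]) and Reynolds' transport theorem
    ([primitive_left_mass]) hold for them.

    Both states solve the equations away from the curve, so only the curve
    matters.  Integrating in space first ([half_plane_step]) and then by parts
    in time reduces the weak equations to two balances on the curve
    ([weak_mass], [weak_momentum]): for every test function [phi], evaluated at
    [(x t, t)],

      [\int (a x' + b alpha E) phi + w phi_t + alpha w u phi_x = 0],

      [\int (- b E x' + e alpha E^2) phi + w u phi_t + alpha w u^2 phi_x
         - sigma w u phi = 0].

    Existence ([shock_existence]).  For [x = c D], [w = k D], [u = c E] the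
    integrands are the derivatives of [w phi] and [w u phi], by the
    Rankine-Hugoniot relations [k = a c + b] and [k c = e - b c].

    Uniqueness ([curve_unique], [weight_unique], [udelta_unique]).  The initial
    data force the curve to start at [0] and the weights to vanish there.
    Testing with functions equal near the curve to [eta t], or to [y * eta t],
    and du Bois-Reymond's lemma give, almost everywhere,

      [w = a x + b D],  [w u = E (- b x + e D)],  [alpha w u = w x'].

    Hence [a x^2 + 2 b x D - e D^2], whose derivative is
    [2 (w x' - alpha w u)], vanishes identically.  This quadratic form is
    [rhop (x - up D)^2 - rhom (x - um D)^2], so it vanishes for
    at most two values of the ratio [s = x / D].  Where [alpha > 0] and
    [D <> 0] the third relation says [x' = alpha E s], so the entropy condition
    is [up < s < um] and leaves only [s = c].  Where [alpha = 0] the entropy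
    condition is silent, but [x' = 0] and [D' = 0]; where [D = 0], also [x = 0].
    In all cases [(x - c D)^2] has derivative zero almost everywhere, so it
    vanishes, and [w] and [u] follow. *)

Set Implicit Arguments.
Unset Strict Implicit.
Unset Printing Implicit Defensive.


(** * Primitives of locally integrable functions on the half line *)

Section primitives.
Context {R : realType}.
Notation mu := (@lebesgue_measure R).
Implicit Types f g F G x y : R -> R.

(** Continuity on [[0, +oo[], expressed by freezing the argument at [0] to the
    left, so that the algebra of everywhere continuous functions applies. *)
Definition cont0 g := continuous (fun t : R => g (Num.max 0 t)).

Definition primitive F f :=
  L1loc f /\ forall t : R, 0 <= t -> F t = F 0 + \int[mu]_(s in `[0, t]) f s.

Lemma bounded_onP (D : set R) g (M : R) :
  (forall t : R, D t -> `|g t| <= M) -> [bounded g t | t in D].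
Proof.
move=> gM; exists M; split; first exact: num_real.
by move=> y My t Dt; apply: le_trans (gM _ Dt) (ltW My).
Qed.

Lemma L1loc_itv f (a b : R) : L1loc f -> 0 <= a ->
  mu.-integrable `[a, b] (EFin \o f).
Proof.
move=> fL a0.
have T0 : (0 : R) < `|b| + 1 by rewrite ltr_wpDl.
have fi := fL _ T0.
apply: (@integrableS _ _ _ mu `[0, `|b| + 1[%classic) => //.
  move=> z /=; rewrite !in_itv/= => /andP[az zb].
  rewrite (le_trans a0 az)/= (le_lt_trans zb)// (le_lt_trans (ler_norm b))//.
  by rewrite ltrDl.
move/integrableP : fi => [mf foo]; apply/integrableP; split.
  have /measurable_EFinP mf' := mf.
  apply/measurable_EFinP; exact/measurable_fun_itv_obnd_cbndP.
rewrite -integral_itv_obnd_cbnd//; by do 2 apply: measurableT_comp => //.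
Qed.

Lemma primitiveB F f (a b : R) : primitive F f -> 0 <= a -> a <= b ->
  F b - F a = \int[mu]_(s in `[a, b]) f s.
Proof.
move=> [fL Ff] a0 ab; rewrite (Ff _ a0) (Ff _ (le_trans a0 ab)) opprD addrACA.
rewrite subrr add0r Rintegral_itvB ?bnd_simp//; last exact: L1loc_itv.
rewrite Rintegral_itv_obnd_cbnd//.
apply: (@integrableS _ _ _ mu `[a, b]%classic) => //; last exact: L1loc_itv.
by apply: subset_itvr; rewrite bnd_simp.
Qed.

Lemma L1locD f g : L1loc f -> L1loc g -> L1loc (fun t => f t + g t).
Proof. by move=> fL gL T T0; exact: (integrableD _ (fL _ T0) (gL _ T0)). Qed.

Lemma L1locZ (c : R) f : L1loc f -> L1loc (fun t => c * f t).
Proof. by move=> fL T T0; exact: (integrableZl _ _ (fL _ T0)). Qed.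

Lemma L1locB f g : L1loc f -> L1loc g -> L1loc (fun t => f t - g t).
Proof. by move=> fL gL T T0; exact: (integrableB _ (fL _ T0) (gL _ T0)). Qed.

Lemma L1loc_norm f : L1loc f -> L1loc (fun t => `|f t|).
Proof. by move=> fL T T0; exact: (integrable_norm (fL _ T0)). Qed.

Lemma L1loc_cst (c : R) : L1loc (fun=> c).
Proof.
move=> T T0; apply: measurable_bounded_integrable => //=.
  by rewrite lebesgue_measure_itv/=; case: ifP => // _; exact: ltry.
exact: (@bounded_onP _ _ `|c|).
Qed.

Lemma cont0_cst (c : R) : cont0 (fun=> c).
Proof. by move=> t; exact: cvg_cst. Qed.

Lemma cont0M f g : cont0 f -> cont0 g -> cont0 (fun t => f t * g t).
Proof. by move=> fc gc t; apply: cvgM; [exact: fc|exact: gc]. Qed.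

Lemma cont0_measurable g (D : set R) : measurable D -> (forall t : R, D t -> 0 <= t) ->
  cont0 g -> measurable_fun D g.
Proof.
move=> mD D0 gc.
apply: (@eq_measurable_fun _ _ _ _ D (fun t => g (Num.max 0 t))).
  by move=> t; rewrite inE => /D0 t0; rewrite max_r.
by apply: measurable_funTS; exact: continuous_measurable_fun.
Qed.

Lemma cont0_bounded g (T : R) : cont0 g ->
  exists2 M : R, 0 < M & forall t : R, 0 <= t -> t <= T -> `|g t| <= M.
Proof.
move=> gc; have [T0|T0] := ltP T 0.
  by exists 1 => // t t0 tT; move: (le_trans t0 tT); rewrite leNgt T0.
have nc : {within `[0, T], continuous (fun t => `|g (Num.max 0 t)|)}.
  apply: continuous_subspaceT => t.
  by apply: continuous_comp; [exact: gc|exact: norm_continuous].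
have [c _ cM] := EVT_max T0 nc.
exists (`|g (Num.max 0 c)| + 1); first by rewrite ltr_wpDl.
move=> t t0 tT; have := cM t; rewrite in_itv/= t0 tT => /(_ isT).
by rewrite (max_r t0) => /le_trans; apply; rewrite lerDl.
Qed.

Lemma L1locM f g : L1loc f -> cont0 g -> L1loc (fun t => f t * g t).
Proof.
move=> fL gc T T0; have [M M0 gM] := cont0_bounded T gc.
apply: (@integrableMl _ _ _ mu `]0, T[%classic _ (EFin \o f) g) => //.
- exact: fL.
- by apply: cont0_measurable => // t /=; rewrite in_itv/= => /andP[/ltW].
- apply: (@bounded_onP _ _ M) => t /=; rewrite in_itv/=.
  by move=> /andP[t0 tT]; apply: gM; exact: ltW.
Qed.

Lemma L1locMl f g : cont0 f -> L1loc g -> L1loc (fun t => f t * g t).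
Proof. by move=> fc gL; under eq_fun do rewrite mulrC; exact: L1locM. Qed.

Lemma cont0_L1loc g : cont0 g -> L1loc g.
Proof.
move=> gc; rewrite (_ : g = fun t => 1 * g t).
  by apply: L1locM => //; exact: L1loc_cst.
by apply/funext => t; rewrite mul1r.
Qed.

(** Converse of [cont0_eps]: the truncation at [0] is a contraction. *)
Lemma cont0P g : (forall t : R, 0 <= t -> forall e : R, 0 < e -> exists2 d : R, 0 < d &
  forall s : R, 0 <= s -> `|s - t| < d -> `|g s - g t| < e) -> cont0 g.
Proof.
move=> H t; apply/cvgrPdist_lt => e e0; move: (t : R) (e : R) e0 => {}t {}e e0.
have [d d0 Hd] := H (Num.max 0 t) (ltac:(by rewrite le_max lexx)) e e0.
near=> s; rewrite distrC; apply: Hd; first by rewrite le_max lexx.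
have : `|s - t| < d by rewrite distrC; near: s; exact: cvgr_dist_lt.
apply: le_lt_trans.
  rewrite /Num.max; case: ifPn; case: ifPn; rewrite -?leNgt => ? ?; rewrite ?subrr ?normr0 ?normr_ge0//.
  - rewrite subr0 gtr0_norm// ger0_norm; lra.
  - rewrite sub0r normrN gtr0_norm// ler0_norm; lra.
Unshelve. all: by end_near. Qed.

Lemma cont0_eps g (t e : R) : cont0 g -> 0 <= t -> 0 < e -> exists2 d : R, 0 < d &
  forall s : R, 0 <= s -> `|s - t| < d -> `|g s - g t| < e.
Proof.
move=> gc t0 e0; have /cvgrPdist_lt/(_ _ e0)/nbhs_ballP[d /= d0 Hd] := gc t.
exists d => // s s0 st; have := Hd s.
by rewrite /ball/= (distrC t s) st max_r// max_r// distrC => /(_ isT).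
Qed.

(** The density is extended by zero to [[-1, 0]], so that continuity at the
    end point [0] becomes continuity at an interior point. *)
Lemma primitive_cont0 F f : primitive F f -> cont0 F.
Proof.
move=> [fL Ff]; apply: cont0P => t t0 e e0.
have tt : (-1 : R) <= t + 1 by lra.
pose fh := f \_ `[0, t + 1].
have ifh : mu.-integrable `[(-1), t + 1] (EFin \o fh).
  rewrite /fh -restrict_EFin; apply/integrable_restrict => //=.
  rewrite setIidr; first exact: L1loc_itv.
  by apply: subset_itvr; rewrite bnd_simp; lra.
have FE (s : R) : 0 <= s -> s <= t + 1 -> F s = F 0 + \int[mu]_(r in `[(-1), s]) fh r.
  move=> s0 st; rewrite (Ff _ s0) -Rintegral_mkcondr.
  congr (_ + Rintegral _ _ _); apply/seteqP; split => z/=; rewrite !in_itv/=; first by lra.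
  by move=> []; lra.
have := parameterized_integral_continuous tt ifh.
move=> /continuous_within_itvP => /(_ ltac:(lra))[+ _ _].
move=> /(_ t ltac:(rewrite in_itv/=; lra)).
move=> /cvgrPdist_lt/(_ _ e0)/nbhs_ballP[d /= d0 Hd].
exists (Num.min d 1); first by rewrite lt_min d0/=.
move=> s s0; rewrite lt_min => /andP[sd s1].
have := Hd s; rewrite /ball/= distrC sd => /(_ isT).
rewrite (FE s)//; last by move: s1; rewrite ltr_norml; lra.
rewrite (FE t)//; last by lra.
by rewrite opprD addrACA subrr add0r distrC.
Qed.

Lemma primitive_cst (c : R) : primitive (fun=> c) (fun=> 0).
Proof.
split; first exact: L1loc_cst.
by move=> t t0; rewrite Rintegral_cst// mul0r addr0.
Qed.

Lemma primitive_id : primitive (fun t => t) (fun=> 1).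
Proof.
split; first exact: L1loc_cst.
move=> t t0; rewrite Rintegral_cst//= lebesgue_measure_itv/=.
by rewrite lte_fin; case: ltP => //= t1; rewrite ?sub0r; lra.
Qed.

Lemma primitiveD F G f g : primitive F f -> primitive G g ->
  primitive (fun t => F t + G t) (fun t => f t + g t).
Proof.
move=> [fL Ff] [gL Gg]; split; first exact: L1locD.
by move=> t t0; rewrite RintegralD//; [rewrite Ff// Gg//; lra|exact: L1loc_itv..].
Qed.

Lemma primitiveZ (c : R) F f : primitive F f ->
  primitive (fun t => c * F t) (fun t => c * f t).
Proof.
move=> [fL Ff]; split; first exact: L1locZ.
by move=> t t0; rewrite RintegralZl//; [rewrite Ff// mulrDr|exact: L1loc_itv].
Qed.

Lemma primitive_int f : L1loc f ->
  primitive (fun t => \int[mu]_(s in `[0, t]) f s) f.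
Proof.
by move=> fL; split => // t t0; rewrite set_itv1 Rintegral_set1 add0r.
Qed.

(** Stated for [s] and [t] in either order, as two-sided expansions around [t]
    require. *)
Lemma primitive_dominated F f N n (s t : R) : primitive F f -> primitive N n ->
  0 <= s -> 0 <= t ->
  (forall r : R, Num.min s t <= r -> r <= Num.max s t -> `|f r| <= n r) ->
  `|F s - F t| <= `|N s - N t|.
Proof.
wlog st : s t / s <= t.
  move=> H Ff Nn s0 t0 fn; have [st|/ltW st] := leP s t; first exact: H.
  by rewrite distrC (distrC (N s)); apply: H => //; rewrite minC maxC.
move=> Ff Nn s0 t0; rewrite min_l// max_r// => fn.
rewrite distrC (distrC (N s)) (@primitiveB F f)// (@primitiveB N n)//.
have fi := L1loc_itv t Ff.1 s0; have ni := L1loc_itv t Nn.1 s0.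
apply: (le_trans (le_normr_Rintegral _ _)) => //.
apply: le_trans (ler_norm _); apply: le_Rintegral => //.
- exact: (integrable_norm fi).
- by move=> r /=; rewrite in_itv/= => /andP[]; exact: fn.
Qed.

Lemma primitive_nondecreasing N n (s t : R) : primitive N n ->
  (forall r : R, 0 <= r -> 0 <= n r) -> 0 <= s -> s <= t -> N s <= N t.
Proof.
move=> Nn n0 s0 st; rewrite -subr_ge0 (@primitiveB N n)//.
apply: Rintegral_ge0 => r/=; rewrite in_itv/= => /andP[sr _].
by apply: n0; exact: le_trans sr.
Qed.

(** A function which is monotone around each point, with that point as one of
    the two points compared, is monotone: the supremum of the points up to
    which monotonicity from [0] holds cannot stop before [T]. *)
Lemma locally_monotone g (T : R) : 0 <= T ->
  (forall t : R, 0 <= t -> exists2 d : R, 0 < d & forall s : R, 0 <= s -> `|s - t| < d ->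
    (t <= s -> g t <= g s) /\ (s <= t -> g s <= g t)) -> g 0 <= g T.
Proof.
move=> T0 H.
pose S := [set t | 0 <= t <= T /\ g 0 <= g t].
have S0 : S 0 by split; rewrite ?lexx ?T0.
have hS : has_sup S by split; [exists 0|exists T => t [/andP[]]].
have c0 : 0 <= sup S by apply: ub_le_sup => //; case: hS.
have cT : sup S <= T by apply: ge_sup; [exists 0|move=> t [/andP[]]].
have [d d0 Hd] := H _ c0.
have [t St tc] := sup_adherent d0 hS.
have tS : t <= sup S by apply: ub_le_sup => //; case: hS.
have gc : g 0 <= g (sup S).
  case: St => /andP[t0 _] /le_trans; apply.
  by apply (Hd t) => //; rewrite ler0_norm; lra.
have [Tc|] := ltP (sup S) T; last by move=> Tc; rewrite -(le_anti (introT andP (conj cT Tc))).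
pose s := Num.min T (sup S + d / 2).
have cs : sup S < s by rewrite /s lt_min Tc/=; lra.
have sd : s <= sup S + d / 2 by rewrite /s ge_min lexx orbT.
have sT : s <= T by rewrite /s ge_min lexx.
have Ss : S s.
  split; first by lra.
  apply: (le_trans gc); apply (Hd s); [lra| |lra].
  by rewrite ger0_norm; lra.
have : s <= sup S by apply: ub_le_sup => //; case: hS.
lra.
Qed.

(** An everywhere condition replaces absolute continuity: increments that agree
    with those of [J] up to [e * |N s - N t|] around every point make
    [e * N + (P - J)] and [e * N - (P - J)] locally monotone, hence monotone, and
    then [e] tends to zero. *)
Lemma primitive_of_increments P J j N n : primitive J j -> primitive N n ->
  (forall r : R, 0 <= r -> 0 <= n r) ->
  (forall t e : R, 0 <= t -> 0 < e -> exists2 d : R, 0 < d & forall s : R, 0 <= s ->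
    `|s - t| < d -> `|(P s - P t) - (J s - J t)| <= e * `|N s - N t|) ->
  primitive P j.
Proof.
move=> Jj Nn n0 H; split; first by case: Jj.
suff : forall T, 0 <= T -> P T - P 0 = J T - J 0.
  by move=> h t t0; have := h _ t0; rewrite (primitiveB Jj (lexx 0) t0); lra.
move=> T T0.
have N0 : 0 <= N T - N 0 by rewrite subr_ge0; exact: primitive_nondecreasing Nn n0 _ _.
suff h e : 0 < e -> `|(P T - P 0) - (J T - J 0)| <= e * (N T - N 0).
  apply/eqP; rewrite -subr_eq0 -normr_le0; apply/ler_addgt0Pr => e e0.
  have N1 : 0 < N T - N 0 + 1 by lra.
  apply: le_trans (h (e / (N T - N 0 + 1)) (divr_gt0 e0 N1)) _.
  by rewrite add0r mulrAC ler_pdivrMr// ler_pM2l//; lra.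
move=> e0.
have mono c : `|c| = 1 -> c * (P 0 - J 0) + e * N 0 <= c * (P T - J T) + e * N T.
  move=> c1.
  apply: (@locally_monotone (fun t => c * (P t - J t) + e * N t)) => // t t0.
  have [d d0 Hd] := H t e t0 e0; exists d => // s s0 sd.
  have := Hd s s0 sd.
  rewrite (_ : P s - P t - (J s - J t) = (P s - J s) - (P t - J t)); last by lra.
  rewrite -[X in X <= _]mul1r -c1 -normrM ler_norml => /andP[]; rewrite mulrBr.
  split=> st.
    have Nst := primitive_nondecreasing Nn n0 t0 st.
    have : `|N s - N t| = N s - N t by rewrite ger0_norm; lra.
    nra.
  have Nst := primitive_nondecreasing Nn n0 s0 st.
  have : `|N s - N t| = N t - N s by rewrite ler0_norm; lra.
  nra.
have := mono 1 (normr1 _); have := mono (-1) (normrN1 _).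
by rewrite ler_norml !mulN1r !mul1r => ? ?; lra.
Qed.

Lemma eq_primitive F f g : (forall t, f t = g t) ->
  primitive F f -> primitive F g.
Proof. by move=> /funext->. Qed.

Lemma dist_between (r s t : R) : Num.min s t <= r -> r <= Num.max s t ->
  `|r - t| <= `|s - t|.
Proof.
rewrite /Num.min /Num.max; case: ltP => st sr rs.
  by rewrite ler0_norm ?ler0_norm; lra.
by rewrite ger0_norm ?ger0_norm; lra.
Qed.

(** The derivative as a first order expansion that also covers [a = z]. *)
Lemma derive_eps f (z df e : R) : is_derive z 1 f df -> 0 < e ->
  exists2 d : R, 0 < d &
  forall a : R, `|a - z| < d ->
    `|f a - f z - df * (a - z)| <= e * `|a - z|.
Proof.
move=> fz e0.
have : h^-1 *: ((f \o shift z) (h *: 1) - f z) @[h --> 0^'] --> df.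
  by case: fz => fz <-; exact: fz.
move=> /cvgrPdist_le/(_ _ e0)/nbhs_ballP[d /= d0 Hd].
exists d => // a ad; have [->|az] := eqVneq a z.
  by rewrite !subrr mulr0 subrr !normr0 mulr0.
have := Hd (a - z); rewrite /ball/= sub0r normrN ad subr_eq0 az => /(_ isT isT).
rewrite /GRing.scale/= mulr1 subrK => H.
have az0 : a - z != 0 by rewrite subr_eq0.
rewrite (_ : _ - _ = - (df - (a - z)^-1 * (f a - f z)) * (a - z)).
  by rewrite normrM normrN ler_wpM2r.
by field.
Qed.

(** The mean value theorem regardless of the order of the end points. *)
Lemma mean_value f df (a b : R) :
  (forall z : R, is_derive z 1 f (df z)) ->
  exists2 c : R, `|c - a| <= `|b - a| & f b - f a = df c * (b - a).
Proof.
move=> fdf; have fc : continuous f.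
  by move=> z; apply/differentiable_continuous/derivable1_diffP; case: (fdf z).
have [ab|ba] := leP a b.
  have [//|c] := @MVT_segment _ f df _ _ ab.
    exact: continuous_subspaceT.
  rewrite in_itv/= => /andP[ac cb] ->; exists c => //.
  by rewrite !ger0_norm; lra.
have [//|c] := @MVT_segment _ f df _ _ (ltW ba).
  exact: continuous_subspaceT.
rewrite in_itv/= => /andP[bc ca] E; exists c; last by lra.
by rewrite !ler0_norm; lra.
Qed.

Lemma eq_of_derive0 f df : (forall w : R, is_derive w 1 f (df w)) ->
  (forall w, df w = 0) -> forall a b : R, f a = f b.
Proof.
move=> fdf df0 a b; have [c _] := mean_value b a fdf.
by rewrite df0 mul0r => /eqP; rewrite subr_eq0 => /eqP.
Qed.

(** Continuous partial derivatives give differentiability: each of the two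
    legs of the displacement is controlled by the mean value theorem. *)
Lemma differentiable_of_partials (H H1 H2 : R -> R -> R) :
  (forall a b : R, is_derive a 1 (H^~ b) (H1 a b)) ->
  (forall a b : R, is_derive b 1 (H a) (H2 a b)) ->
  continuous (fun p : R * R => H1 p.1 p.2) ->
  continuous (fun p : R * R => H2 p.1 p.2) ->
  forall z t e : R, 0 < e -> exists2 d : R, 0 < d &
    forall a b : R, `|a - z| < d -> `|b - t| < d ->
    `|H a b - H z t - (H1 z t * (a - z) + H2 z t * (b - t))| <=
      e * (`|a - z| + `|b - t|).
Proof.
move=> dH1 dH2 cH1 cH2 z t e e0.
have nearp (G : R -> R -> R) : continuous (fun p : R * R => G p.1 p.2) ->
    exists2 d : R, 0 < d & forall a b : R, `|a - z| < d -> `|b - t| < d ->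
      `|G a b - G z t| <= e.
  move=> cG; have /cvgrPdist_le/(_ _ e0)/nbhs_ballP[d /= d0 Hd] := cG (z, t).
  exists d => // a b az bt; rewrite distrC; apply: (Hd (a, b)).
  by split; rewrite /ball/= distrC.
have [d1 d10 Hd1] := nearp _ cH1; have [d2 d20 Hd2] := nearp _ cH2.
exists (Num.min d1 d2); first by rewrite lt_min d10.
move=> a b; rewrite !lt_min => /andP[a1 a2] /andP[b1 b2].
have [c cz Hc] := @mean_value (H^~ b) (H1^~ b) z a (fun w => dH1 w b).
have [c' ct Hc'] := @mean_value (H z) (H2 z) t b (fun w => dH2 z w).
rewrite (_ : _ - _ = (H1 c b - H1 z t) * (a - z) + (H2 z c' - H2 z t) * (b - t)).
  rewrite (le_trans (ler_normD _ _))// !normrM mulrDr lerD// ler_wpM2r//.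
    by apply: Hd1 => //; exact: le_lt_trans cz _.
  by apply: Hd2; rewrite ?subrr ?normr0//; exact: le_lt_trans ct _.
by rewrite !mulrBl -Hc -Hc'; ring.
Qed.

(** Chain rule: [H] is only assumed differentiable along the curve [(x, y)],
    with partial derivatives [p] and [q] that are continuous along it.  Near
    [t] the increment of [H (x, y)] is [p t * dx + q t * dy] up to a small
    multiple of [|dx| + |dy|], and so is that of the candidate primitive. *)
Lemma primitive_chain (H : R -> R -> R) (p q : R -> R) x v y w :
  primitive x v -> primitive y w -> cont0 p -> cont0 q ->
  (forall t e : R, 0 <= t -> 0 < e -> exists2 d : R, 0 < d &
    forall a b : R, `|a - x t| < d -> `|b - y t| < d ->
    `|H a b - H (x t) (y t) - (p t * (a - x t) + q t * (b - y t))| <=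
      e * (`|a - x t| + `|b - y t|)) ->
  primitive (fun t => H (x t) (y t)) (fun t => p t * v t + q t * w t).
Proof.
move=> xv yw pc qc HH.
pose n t := `|v t| + `|w t|.
have nL : L1loc n by apply: L1locD; apply: L1loc_norm; [case: xv|case: yw].
have jL : L1loc (fun t => p t * v t + q t * w t).
  apply: L1locD; under eq_fun do rewrite mulrC; apply: L1locM => //.
    by case: xv.
  by case: yw.
have Nn := primitive_int nL; have Jj := primitive_int jL.
set N := (fun t => _) in Nn; set J := (fun t => _) in Jj.
apply: (primitive_of_increments Jj Nn) => [r r0|t e t0 e0].
  by rewrite /n addr_ge0.
have e3 : 0 < e / 3 by lra.
have [d d0 Hd] := HH t _ t0 e3.
have [d1 d10 Hd1] := cont0_eps (primitive_cont0 xv) t0 d0.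
have [d2 d20 Hd2] := cont0_eps (primitive_cont0 yw) t0 d0.
have [d3 d30 Hd3] := cont0_eps pc t0 e3.
have [d4 d40 Hd4] := cont0_eps qc t0 e3.
exists (Num.min (Num.min d1 d2) (Num.min d3 d4)); first by rewrite !lt_min d10 d20 d30 d40.
move=> s s0; rewrite !lt_min => /andP[/andP[sd1 sd2] /andP[sd3 sd4]].
have dx : `|x s - x t| <= `|N s - N t|.
  by apply: (primitive_dominated xv Nn) => // r _ _; rewrite /n lerDl.
have dy : `|y s - y t| <= `|N s - N t|.
  by apply: (primitive_dominated yw Nn) => // r _ _; rewrite /n lerDr.
have K := primitiveD Jj (primitiveD (primitiveZ (- p t) xv) (primitiveZ (- q t) yw)).
have KN := primitiveZ (e / 3) Nn.
have : `|(J s + (- p t * x s + - q t * y s)) - (J t + (- p t * x t + - q t * y t))|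
    <= `|e / 3 * N s - e / 3 * N t|.
  apply: (primitive_dominated K KN) => // r sr rs.
  have r0 : 0 <= r by apply: le_trans sr; rewrite le_min s0 t0.
  have rt := dist_between sr rs.
  rewrite [X in `|X|](_ : _ = (p r - p t) * v r + (q r - q t) * w r); last by ring.
  rewrite (le_trans (ler_normD _ _))// !normrM /n mulrDr.
  by apply: lerD; apply: ler_wpM2r => //; apply/ltW;
    [apply: Hd3|apply: Hd4] => //; exact: le_lt_trans rt _.
rewrite -mulrBr normrM (gtr0_norm e3) => KJ.
have := Hd _ _ (Hd1 _ s0 sd1) (Hd2 _ s0 sd2) => HP.
have {}HP : `|H (x s) (y s) - H (x t) (y t) -
    (p t * (x s - x t) + q t * (y s - y t))| <= e / 3 * (`|N s - N t| + `|N s - N t|).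
  by apply: (le_trans HP); rewrite ler_pM2l//; exact: lerD.
have -> : e * `|N s - N t| = e / 3 * (`|N s - N t| + `|N s - N t|) + e / 3 * `|N s - N t|.
  by field.
apply: le_trans (lerD HP KJ); apply: le_trans (ler_normB _ _).
by rewrite le_eqVlt; apply/orP; left; apply/eqP; congr (`|_|); ring.
Qed.

(** Chain rule for the product of two numbers, whose second order remainder is
    the product of the increments. *)
Lemma primitiveM F f G g : primitive F f -> primitive G g ->
  primitive (fun t => F t * G t) (fun t => f t * G t + F t * g t).
Proof.
move=> Ff Gg.
apply: (@eq_primitive _ (fun t => G t * f t + F t * g t)).
  by move=> t; rewrite mulrC.
apply: (@primitive_chain *%R) => //; try exact: (@primitive_cont0 _ _ Ff); try exact: (@primitive_cont0 _ _ Gg).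
move=> t e t0 e0; exists e => // a b ae be.
rewrite (_ : _ - _ = (a - F t) * (b - G t)); last by ring.
by rewrite normrM mulrDr ler_wpDl ?mulr_ge0 ?(ltW e0)// ler_wpM2r// ltW.
Qed.

Lemma primitive_expR F f : primitive F f ->
  primitive (fun t => expR (F t)) (fun t => expR (F t) * f t).
Proof.
move=> Ff.
apply: (@eq_primitive _ (fun t => expR (F t) * f t + 0 * 0)).
  by move=> t; rewrite mulr0 addr0.
apply: (@primitive_chain (fun a _ => expR a) _ (fun=> 0) _ _ (fun=> 0) (fun=> 0)) => //.
- exact: primitive_cst.
- move=> t; apply: continuous_comp; last exact: continuous_expR.
  exact: (primitive_cont0 Ff).
- by move=> t; exact: cvg_cst.
move=> t e t0 e0.
have [d d0 Hd] := derive_eps (is_derive_expR (F t)) e0.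
exists d => // a b aF _; rewrite mul0r addr0.
have /le_trans := Hd _ aF; apply.
by rewrite ler_pM2l// lerDl.
Qed.

Lemma continuous_along (G : R -> R -> R) f g :
  continuous (fun p : R * R => G p.1 p.2) -> continuous f -> continuous g ->
  continuous (fun t => G (f t) (g t)).
Proof.
move=> cG cf cg t; apply/cvgrPdist_lt => e e0.
have /cvgrPdist_lt/(_ _ e0)/nbhs_ballP[d /= d0 Hd] := cG (f t, g t).
have /cvgrPdist_lt/(_ _ d0) Hf := cf t.
have /cvgrPdist_lt/(_ _ d0) Hg := cg t.
by near=> s; apply: (Hd (f s, g s)); split; rewrite /ball/=; near: s.
Unshelve. all: by end_near. Qed.

Lemma primitive_comp (H H1 H2 : R -> R -> R) x v :
  (forall a b : R, is_derive a 1 (H^~ b) (H1 a b)) ->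
  (forall a b : R, is_derive b 1 (H a) (H2 a b)) ->
  continuous (fun p : R * R => H1 p.1 p.2) ->
  continuous (fun p : R * R => H2 p.1 p.2) ->
  primitive x v ->
  primitive (fun t => H (x t) t) (fun t => H1 (x t) t * v t + H2 (x t) t).
Proof.
move=> dH1 dH2 cH1 cH2 xv.
have cx := primitive_cont0 xv.
have cc (G : R -> R -> R) : continuous (fun p : R * R => G p.1 p.2) ->
    cont0 (fun t => G (x t) t).
  by move=> cG; exact: continuous_along cG cx (primitive_cont0 primitive_id).
apply: (@eq_primitive _ (fun t => H1 (x t) t * v t + H2 (x t) t * 1)).
  by move=> t; rewrite mulr1.
apply: (@primitive_chain H) => //; [exact: primitive_id|exact: cc|exact: cc|].
by move=> t e t0 e0; exact: differentiable_of_partials.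
Qed.

End primitives.


(** * Test functions and their partial masses *)

Section partial_masses.
Context {R : realType}.
Notation mu := (@lebesgue_measure R).
Implicit Types (f g x v : R -> R) (phi psi : R -> R -> R).

Lemma near0_derive1 f (z : R) : (\forall w \near z, f w = 0) -> derive1 f z = 0.
Proof.
move=> f0; rewrite derive1E (@near_eq_derive _ _ _ f (cst 0)) ?derive_cst//.
Qed.

(** Partial derivatives do not enlarge the support, whose complement is open. *)
Lemma partial_support (s : seq bool) phi (p : R * R) :
  ~ closure [set p : R * R | phi p.1 p.2 != 0] p -> partial s phi p.1 p.2 = 0.
Proof.
set S := closure _; move: p; elim: s => [p|b s IH [y t] Sp].
  by apply: contra_notP => /eqP p0; exact: subset_closure.
have : \forall q \near (y, t), ~ S q.
  by apply: open_nbhs_nbhs; split => //; apply: closed_openC; exact: closed_closure.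
move=> /nbhs_ballP[d /= d0 Hd].
case: b => /=; apply: near0_derive1; apply/nbhs_ballP; exists d => // w Bw.
  by apply: (IH (y, w)); apply: Hd; split => //=; exact: ballxx.
by apply: (IH (w, t)); apply: Hd; split => //=; exact: ballxx.
Qed.

Lemma test_function_box phi : test_function phi -> exists K T : R,
  [/\ 0 < K, 0 < T &
   forall s y t, ~ (`|y| < K /\ 0 < t < T) -> partial s phi y t = 0].
Proof.
move=> [_ cS S0].
have [M M0 SM] := ex_strict_bound_gt0 (compact_bounded cS).
exists M, M; split => // s y t yt; apply: (@partial_support s phi (y, t)) => Syt.
apply: yt; have t0 : 0 < t := S0 _ Syt.
have := SM _ Syt; rewrite /= prod_normE/= gt_max => /andP[-> tM].
by rewrite t0 (le_lt_trans (ler_norm t)).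
Qed.

Lemma cc_integrable f (K : R) : continuous f -> (forall y, K <= `|y| -> f y = 0) ->
  mu.-integrable [set: R] (EFin \o f).
Proof.
move=> cf f0.
have mK : measurable (`[(- K), K]%classic : set R) by [].
have : mu.-integrable [set: R] ((EFin \o f) \_ `[(- K), K]).
  apply: (proj1 (@integrable_mkcond _ _ _ mu _ (EFin \o f) mK)).
  apply: continuous_compact_integrable.
    exact: segment_compact.
  exact: continuous_subspaceT.
apply: eq_integrable => // y _; rewrite patchE; case: ifPn => //.
move=> /negP; rewrite inE /= in_itv/= -ler_norml => /negP; rewrite -ltNge => Ky.
by rewrite /= f0// ltW.
Qed.

(** The bound does not depend on the domain of integration: only the length of
    an interval containing the support matters. *)
Lemma cc_int_bound (D : set R) f (K C : R) : measurable D -> 0 <= K ->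
  continuous f -> (forall y, K <= `|y| -> f y = 0) -> (forall y, `|f y| <= C) ->
  `|\int[mu]_(y in D) f y| <= 2 * K * C.
Proof.
move=> mD K0 cf f0 fC.
have mK : measurable (`[(- K), K]%classic : set R) by [].
have fi := cc_integrable cf f0.
have C0 : 0 <= C := le_trans (normr_ge0 _) (fC 0).
have fD : mu.-integrable D (EFin \o f) by exact: integrableS fi.
apply: (le_trans (le_normr_Rintegral _ _)) => //.
rewrite -lee_fin /Rintegral fineK; last first.
  by apply: integrable_fin_num => //; exact: integrable_norm.
apply: (@le_trans _ _ (\int[mu]_y ((C * \1_(`[(- K), K]%classic) y)%:E))%E); last first.
  under eq_integral do rewrite EFinM.
  rewrite ge0_integralZl//.
  - rewrite integral_indic//= setIT lebesgue_measure_itv/= lte_fin.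
    by case: ifPn => _; rewrite -?EFinB -?EFinM lee_fin; nra.
  - exact/measurable_EFinP.
rewrite [X in (X <= _)%E]integral_mkcond; apply: ge0_le_integral => //.
- by move=> y _; rewrite patchE; case: ifP => // _; rewrite lee_fin.
- apply/(measurable_restrictT _ _).1 => //; apply/measurable_EFinP.
  apply: measurableT_comp => //; apply: measurable_funTS.
  exact: continuous_measurable_fun.
- by apply/measurable_EFinP; exact: measurable_funM.
- move=> y _; rewrite patchE indicE; case: ifP => _; last first.
    by rewrite lee_fin mulr_ge0.
  rewrite lee_fin mem_setE in_itv/= -ler_norml.
  move: (y : R) => {}y; have [yK|/ltW Ky] := leP `|y| K; first by rewrite mulr1.
  by rewrite mulr0 f0// normr0.
Qed.

Section left_mass.
Variable K : R.
Hypothesis K0 : 0 <= K.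

(** The functions to which the partial masses apply: continuous, and supported
    in a strip [|y| <= K]. *)
Definition strip psi := continuous (fun p : R * R => psi p.1 p.2) /\
  forall y t, K <= `|y| -> psi y t = 0.

Definition left_mass psi (z t : R) := \int[mu]_(y in `]-oo, z]) psi y t.

Lemma strip_slice psi (t : R) : strip psi -> continuous (psi^~ t).
Proof.
move=> [cpsi _]; apply: (continuous_along cpsi) => y; first exact: cvg_id.
exact: cvg_cst.
Qed.

Lemma strip_integrable psi (t : R) : strip psi ->
  mu.-integrable [set: R] (EFin \o psi^~ t).
Proof.
by move=> spsi; apply: (@cc_integrable _ K) => [|y /spsi.2//]; exact: strip_slice.
Qed.

Lemma left_mass_derive psi (z t : R) : strip psi ->
  is_derive z 1 (left_mass psi ^~ t) (psi z t).
Proof.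
move=> spsi.
have zu : z < z + 1 by rewrite ltrDl.
have iu : mu.-integrable [set` Interval -oo%O (BRight (z + 1))] (EFin \o psi^~ t).
  by apply: integrableS (strip_integrable t spsi).
have [|d1 <-] := continuous_FTC1 zu iu _ (@strip_slice _ t spsi z).
  by rewrite ltNyr.
by rewrite derive1E; apply: DeriveDef.
Qed.

Lemma left_massB psi psi' (z t t' : R) : strip psi -> strip psi' ->
  left_mass psi z t - left_mass psi' z t' =
  \int[mu]_(y in `]-oo, z]) (psi y t - psi' y t').
Proof.
move=> spsi spsi'; rewrite /left_mass RintegralB//.
  by apply: integrableS (strip_integrable t spsi).
by apply: integrableS (strip_integrable t' spsi').
Qed.

Lemma left_mass_lip psi (M z z' t : R) : strip psi ->
  (forall y t, `|psi y t| <= M) ->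
  `|left_mass psi z' t - left_mass psi z t| <= M * `|z' - z|.
Proof.
move=> spsi psiM.
have [c _ ->] := mean_value z z' (fun w => left_mass_derive w t spsi).
by rewrite normrM ler_wpM2r.
Qed.

Lemma left_mass_far psi (z t : R) : strip psi -> z <= - K -> left_mass psi z t = 0.
Proof.
move=> [_ s0] zK; rewrite /left_mass (@eq_Rintegral _ _ _ _ _ (cst 0)).
  by rewrite Rintegral_cst// mul0r.
by move=> y; rewrite inE/= in_itv/= => yz; rewrite s0// ler_normr; apply/orP; right; lra.
Qed.

(** Both sides have the same derivative in [z] and vanish at the left end of the
    strip. *)
Lemma left_mass_dx psi dpsi (z t : R) : strip psi -> strip dpsi ->
  (forall y t : R, is_derive y 1 (psi^~ t) (dpsi y t)) ->
  left_mass dpsi z t = psi z t.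
Proof.
move=> spsi sdpsi H.
have D (w : R) : is_derive w 1 (fun y => left_mass dpsi y t - psi y t) (dpsi w t - dpsi w t).
  by apply: is_deriveB; exact: left_mass_derive.
have := eq_of_derive0 D (fun w => subrr _) z (- K).
rewrite (@left_mass_far _ (- K))// (spsi.2 (- K)) ?subrr//.
  by move=> /eqP; rewrite subr_eq0 => /eqP.
by rewrite normrN ger0_norm.
Qed.

(** Bounded second derivatives in time give a first order expansion, uniform
    in space, that integrates over the strip. *)
Lemma left_mass_expand psi dpsi ddpsi (M z t t' : R) :
  strip psi -> strip dpsi ->
  (forall y t : R, is_derive t 1 (psi y) (dpsi y t)) ->
  (forall y t : R, is_derive t 1 (dpsi y) (ddpsi y t)) ->
  (forall y t, `|ddpsi y t| <= M) ->
  `|left_mass psi z t' - left_mass psi z t - left_mass dpsi z t * (t' - t)| <=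
  2 * K * (M * `|t' - t| ^+ 2).
Proof.
move=> spsi sdpsi H1 H2 ddM.
have i1 (f : R -> R -> R) s : strip f -> mu.-integrable `]-oo, z] (EFin \o f^~ s).
  by move=> sf; apply: integrableS (strip_integrable s sf).
rewrite left_massB// /left_mass -RintegralZr//; last exact: i1.
rewrite -RintegralB//; last 2 first.
- exact: (integrableB _ (i1 _ _ _) (i1 _ _ _)).
- exact: (integrableZr _ _ (i1 _ _ _)).
apply: cc_int_bound => //.
- move=> y; apply: cvgB; first by apply: cvgB; exact: strip_slice.
  by apply: cvgM; [exact: strip_slice|exact: cvg_cst].
- by move=> y Ky; rewrite !(spsi.2, sdpsi.2)// subrr mul0r subrr.
- move=> y; have [c ct ->] := mean_value t t' (H1 y).
  have [c' _ E] := mean_value t c (H2 y).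
  rewrite -mulrBl E normrM expr2 mulrA normrM -mulrA -mulrA.
  by rewrite ler_pM// ler_wpM2r.
Qed.

Lemma left_mass_continuous psi dpsi (M M' : R) x : strip psi ->
  (forall y t : R, is_derive t 1 (psi y) (dpsi y t)) ->
  (forall y t, `|psi y t| <= M) -> (forall y t, `|dpsi y t| <= M') ->
  cont0 x -> cont0 (fun t => left_mass psi (x t) t).
Proof.
move=> spsi H1 psiM dpsiM cx; apply: cont0P => t t0 e e0.
have M0 : 0 <= M := le_trans (normr_ge0 _) (psiM 0 0).
have M0' : 0 <= M' := le_trans (normr_ge0 _) (dpsiM 0 0).
have p1 : 0 < M + 1 by lra.
have p2 : 0 < 2 * K * M' + 1 by have := mulr_ge0 K0 M0'; nra.
have [d d0 Hd] := cont0_eps cx t0 (divr_gt0 (divr_gt0 e0 (ltr0n _ 2)) p1).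
exists (Num.min d (e / 2 / (2 * K * M' + 1))).
  by rewrite lt_min d0 !divr_gt0.
move=> s s0; rewrite lt_min => /andP[sd se].
rewrite -(subrKA (left_mass psi (x t) s)).
have h1 := left_mass_lip (x t) (x s) s spsi psiM.
have h2 : `|left_mass psi (x t) s - left_mass psi (x t) t| <= 2 * K * (M' * `|s - t|).
  rewrite left_massB//; apply: cc_int_bound => //.
  - by move=> y; apply: cvgB; exact: strip_slice.
  - by move=> y Ky; rewrite !spsi.2// subrr.
  - by move=> y; have [c _ ->] := mean_value t s (H1 y); rewrite normrM ler_wpM2r.
have h3 := Hd s s0 sd; move: se h3; rewrite !ltr_pdivlMr// => se h3.
apply: (le_lt_trans (ler_normD _ _)).
have h4 := normr_ge0 (s - t); have h5 := normr_ge0 (x s - x t).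
have := mulr_ge0 K0 M0'; nra.
Qed.

(** Reynolds transport: the mass to the left of a moving point varies by the
    flux through the point and by the variation of the density. *)
Lemma primitive_left_mass psi dpsi ddpsi (M : R) x v :
  strip psi -> strip dpsi ->
  (forall y t : R, is_derive t 1 (psi y) (dpsi y t)) ->
  (forall y t : R, is_derive t 1 (dpsi y) (ddpsi y t)) ->
  (forall y t, `|dpsi y t| <= M) -> (forall y t, `|ddpsi y t| <= M) ->
  primitive x v ->
  primitive (fun t => left_mass psi (x t) t)
    (fun t => psi (x t) t * v t + left_mass dpsi (x t) t).
Proof.
move=> spsi sdpsi H1 H2 dM ddM xv.
have cx := primitive_cont0 xv.
have M0 : 0 <= M := le_trans (normr_ge0 _) (dM 0 0).
apply: (@eq_primitive _ _ (fun t => psi (x t) t * v t + left_mass dpsi (x t) t * 1)).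
  by move=> t; rewrite mulr1.
apply: (@primitive_chain _ (left_mass psi)) => //.
- exact: primitive_id.
- exact: (continuous_along spsi.1 cx (primitive_cont0 primitive_id)).
- exact: (left_mass_continuous sdpsi H2 dM ddM cx).
move=> t e t0 e0.
have [d d0 Hd] := derive_eps (left_mass_derive (x t) t spsi) e0.
pose C := 2 * K * M + M + 1.
have KM := mulr_ge0 K0 M0.
have C0 : 0 < C by rewrite /C; nra.
exists (Num.min d (e / C)); first by rewrite lt_min d0 divr_gt0.
move=> a b; rewrite !lt_min => /andP[ad aC] /andP[bd bC].
rewrite (_ : _ - _ = (left_mass psi a b - left_mass psi a t - left_mass dpsi a t * (b - t))
   + (left_mass dpsi a t - left_mass dpsi (x t) t) * (b - t)
   + (left_mass psi a t - left_mass psi (x t) t - psi (x t) t * (a - x t))); last by ring.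
have h1 := left_mass_expand a t b spsi sdpsi H1 H2 ddM.
have h2 := left_mass_lip (x t) a t sdpsi dM.
have h3 := Hd _ ad.
rewrite (le_trans (ler_normD _ _))// [leRHS]mulrDr [leRHS]addrC lerD//.
rewrite (le_trans (ler_normD _ _))// normrM.
move: aC bC; rewrite !ltr_pdivlMr// => aC bC.
have := normr_ge0 (a - x t); have := normr_ge0 (b - t).
move: h1 h2 aC bC; move: `|a - x t| `|b - t| => A B h1 h2 aC bC B0 A0.
have : `|left_mass dpsi a t - left_mass dpsi (x t) t| * B <= M * A * B by rewrite ler_wpM2r.
have : 2 * K * (M * B ^+ 2) + M * A * B <= e * B.
  have -> : 2 * K * (M * B ^+ 2) + M * A * B = (2 * (K * M) * B + M * A) * B by ring.
  rewrite ler_wpM2r//; rewrite /C in aC bC.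
  have [AB|BA] := leP A B.
    by have := ler_wpM2l M0 AB; lra.
  by have := ler_wpM2l KM (ltW BA); lra.
lra.
Qed.

End left_mass.

End partial_masses.


(** * Integrals of step profiles over the half plane *)

Section step_profiles.
Context {R : realType}.
Notation mu := (@lebesgue_measure R).
Implicit Types (f g x v : R -> R) (phi psi : R -> R -> R).

Lemma step_integrable f (z a b : R) : mu.-integrable [set: R] (EFin \o f) ->
  mu.-integrable [set: R] (fun y => ((if y < z then a else b) * f y)%:E).
Proof.
move=> fi.
apply: (@integrableMr _ _ _ mu setT _ (fun y => if y < z then a else b) (EFin \o f)) => //.
  apply: measurable_fun_ifT => //; exact: measurable_fun_ltr.
by apply: (@bounded_onP _ _ _ (`|a| + `|b|)) => y _; case: ifP => _; rewrite ?lerDl ?lerDr.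
Qed.

(** The jump is split off as [a - b] times an indicator. *)
Lemma step_integral f (z a b : R) : mu.-integrable [set: R] (EFin \o f) ->
  \int[mu]_y ((if y < z then a else b) * f y) =
  a * (\int[mu]_(y in `]-oo, z]) f y) +
  b * (\int[mu]_y f y - \int[mu]_(y in `]-oo, z]) f y).
Proof.
move=> fi.
have mz : measurable (`]-oo, z[%classic : set R) by [].
have fzi : mu.-integrable [set: R] (EFin \o (f \_ `]-oo, z[)).
  rewrite -restrict_EFin; apply: (proj1 (integrable_mkcond _ _)) => //.
  exact: integrableS fi.
have -> : (fun y => (if y < z then a else b) * f y) =
    (fun y => b * f y + (a - b) * (f \_ `]-oo, z[) y).
  apply/funext => y; rewrite patchE mem_setE in_itv/=; case: ifP => _ /=.
    by ring.
  by rewrite mulr0 addr0.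
rewrite RintegralD//; last 2 first.
- exact: (integrableZl _ _ fi).
- exact: (integrableZl _ _ fzi).
rewrite !RintegralZl// -Rintegral_mkcond Rintegral_itv_bndo_bndc; last exact: integrableS fi.
ring.
Qed.

Lemma left_mass_total (K t : R) psi : 0 <= K -> strip K psi ->
  left_mass psi K t = \int[mu]_y psi y t.
Proof.
move=> K0 spsi; rewrite /left_mass Rintegral_mkcond; apply: eq_Rintegral => y _.
rewrite patchE mem_setE in_itv/=; case: leP => // Ky.
by rewrite spsi.2// (le_trans (ltW Ky))// ler_norm.
Qed.

(** Graphs are negligible, by Tonelli's theorem in the space variable first. *)
Lemma graph_negligible x : measurable_fun [set: R] x ->
  measurable [set p : R * R | p.1 = x p.2] /\
  (mu \x mu)%E [set p : R * R | p.1 = x p.2] = 0%E.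
Proof.
move=> mx.
have mG : measurable [set p : R * R | p.1 = x p.2].
  have := @measurable_fun_eqr _ _ R setT (fun p : R * R => p.1) (fun p => x p.2)
     measurable_fst (measurableT_comp mx measurable_snd).
  move=> /(_ measurableT [set true] I); rewrite setTI.
  by congr measurable; apply/seteqP; split => p /= /eqP.
split => //.
have := @integral_indic _ _ R (mu \x mu)%E setT measurableT _ mG.
rewrite setIT => <-; rewrite fubini_tonelli2//; last exact/measurable_EFinP.
apply: integral0_eq => t _; rewrite /fubini_G/=.
transitivity (\int[mu]_y (\1_[set x t] y)%:E)%E.
  apply: eq_integral => y _; rewrite !indicE; congr (_%:R%:E).
by rewrite integral_indic//= setIT lebesgue_measure_set1.
Qed.

(** An open set of the plane is the union of the rational boxes inside it. *)
Lemma open_measurable2 (O : set (R * R)) : open O -> measurable O.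
Proof.
move=> oO.
pose box (q : (rat * rat) * (rat * rat)) : set (R * R) :=
  `]ratr q.1.1, ratr q.1.2[%classic `*` `]ratr q.2.1, ratr q.2.2[%classic.
have -> : O = \bigcup_q (if `[< box q `<=` O >] then box q else set0).
  apply/seteqP; split => [[y t] Oyt|p [q _]]; last by case: asboolP => // h /h.
  have : nbhs (y, t) O by exact: open_nbhs_nbhs.
  move=> /nbhs_ballP[d /= d0 Hd].
  have [a1] := rat_in_itvoo (ltac:(lra) : y - d < y).
  have [b1] := rat_in_itvoo (ltac:(lra) : y < y + d).
  have [a2] := rat_in_itvoo (ltac:(lra) : t - d < t).
  have [b2] := rat_in_itvoo (ltac:(lra) : t < t + d).
  rewrite !in_itv/= => /andP[b21 b22] /andP[a21 a22] /andP[b11 b12] /andP[a11 a12].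
  exists ((a1, b1), (a2, b2)) => //.
  rewrite asboolT; first by split; rewrite /= in_itv/= ?a12 ?b11 ?a22 ?b21.
  move=> [y' t'] [/=]; rewrite !in_itv/= => /andP[h1 h2] /andP[h3 h4].
  by apply: Hd; split; rewrite /ball/= ltr_norml; lra.
apply: countable_bigcupT_measurable; first exact: countableP.
by move=> q; case: ifP => // _; exact: measurableX.
Qed.

Lemma continuous_measurable2 (G : R -> R -> R) :
  continuous (fun p : R * R => G p.1 p.2) ->
  measurable_fun [set: R * R] (fun p : R * R => G p.1 p.2).
Proof.
move=> /continuousP cG; apply: (measurability _ (RGenOpens.measurableE R)).
move=> _ [_ [a [b ->] <-]]; rewrite setTI; apply: open_measurable2.
exact/cG/interval_open.
Qed.

(** The integrable majorant on which Fubini's theorem rests in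
    [half_plane_step]. *)
Lemma product_integrable (b : R -> R) (K : R) : 0 <= K ->
  mu.-integrable [set: R] (EFin \o b) ->
  (mu \x mu)%E.-integrable [set: R * R]
    (fun p : R * R => (b p.2 * \1_(`[(- K), K]%classic) p.1)%:E).
Proof.
move=> K0 bi.
have /measurable_EFinP mb := measurable_int _ bi.
apply: (proj2 (integrable21ltyP _ _ _)).
  apply/measurable_EFinP; apply: measurable_funM.
    exact: (measurableT_comp mb measurable_snd).
  apply: (measurableT_comp _ measurable_fst); exact: measurable_indic.
rewrite /=.
have inner t : (\int[mu]_y `|(b t * \1_(`[(- K), K]%classic) y)%:E| =
    (2 * K)%:E * `|b t|%:E)%E.
  under eq_integral => y _.
    rewrite /= normrM indicE (ger0_norm (ler0n _ _)) -indicE EFinM; over.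
  rewrite ge0_integralZl//; last by apply/measurable_EFinP; exact: measurable_indic.
  rewrite integral_indic//= setIT lebesgue_measure_itv/= lte_fin muleC.
  case: ifPn => h; last by move: h; rewrite -leNgt => h; have -> : K = 0 by [lra]; rewrite mulr0.
  by rewrite -?EFinB -?EFinM; congr (_%:E); ring.
under eq_integral => t _ do rewrite inner.
rewrite ge0_integralZl//.
- apply: lte_mul_pinfty => //; first by rewrite lee_fin; lra.
  by case/integrableP: bi.
- by apply/measurable_EFinP; exact: measurableT_comp.
- by rewrite lee_fin; lra.
Qed.

(** Integral over the half plane of a function that equals, off the curve, a
    profile with one jump across the curve: integrating in space first leaves
    the masses of the test function on both sides. *)
Lemma half_plane_step (K T M : R) (b Am Ap x : R -> R) psi (Q : R * R -> R) :
  0 <= K -> 0 < T -> L1loc b -> cont0 Am -> cont0 Ap -> cont0 x -> strip K psi ->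
  (forall y t, ~ (0 < t < T) -> psi y t = 0) ->
  (forall y t, `|psi y t| <= M) ->
  measurable_fun (@half_plane R) Q ->
  (forall y t, 0 < t -> y <> x t ->
     Q (y, t) = b t * (if y < x t then Am t else Ap t) * psi y t) ->
  \int[(mu \x mu)%E]_(p in half_plane) Q p =
  \int[mu]_(t in `]0, T[) (b t * (Am t * left_mass psi (x t) t +
     Ap t * (left_mass psi K t - left_mass psi (x t) t))).
Proof.
move=> K0 T0 bL Amc Apc xc spsi psiT psiM mQ Qeq.
pose b0 := b \_ `]0, T[.
pose x0 t := x (Num.max 0 t).
have b0i : mu.-integrable [set: R] (EFin \o b0).
  by rewrite /b0 -restrict_EFin; apply: (proj1 (integrable_mkcond _ _)) => //; exact: bL.
have /measurable_EFinP mb0 := measurable_int _ b0i.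
have mx0 : measurable_fun [set: R] x0 by exact: continuous_measurable_fun.
have mAm : measurable_fun [set: R] (fun t => Am (Num.max 0 t)) by exact: continuous_measurable_fun.
have mAp : measurable_fun [set: R] (fun t => Ap (Num.max 0 t)) by exact: continuous_measurable_fun.
pose S (p : R * R) := if p.1 < x0 p.2 then Am (Num.max 0 p.2) else Ap (Num.max 0 p.2).
pose Q0 (p : R * R) := b0 p.2 * S p * psi p.1 p.2.
have mpsi : measurable_fun [set: R * R] (fun p : R * R => psi p.1 p.2).
  exact: continuous_measurable2 spsi.1.
have mS : measurable_fun [set: R * R] S.
  apply: measurable_fun_ifT.
  - apply: measurable_fun_ltr; first exact: measurable_fst.
    exact: (measurableT_comp mx0 measurable_snd).
  - exact: (measurableT_comp mAm measurable_snd).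
  - exact: (measurableT_comp mAp measurable_snd).
have mQ0 : measurable_fun [set: R * R] Q0.
  apply: measurable_funM => //; apply: measurable_funM => //.
  exact: (measurableT_comp mb0 measurable_snd).
have [Bm Bm0 HBm] := cont0_bounded T Amc.
have [Bp Bp0 HBp] := cont0_bounded T Apc.
have M0 : 0 <= M := le_trans (normr_ge0 _) (psiM 0 0).
pose C := (Bm + Bp) * M.
have C0 : 0 <= C by rewrite mulr_ge0// addr_ge0// ltW.
have Q0i : (mu \x mu)%E.-integrable [set: R * R] (EFin \o Q0).
  have ci : mu.-integrable [set: R] (EFin \o (fun t => C * b0 t)).
    exact: (integrableZl _ _ b0i).
  apply: (le_integrable _ _ _ (product_integrable K0 ci)) => //.
    exact/measurable_EFinP.
  move=> [y t] _ /=; rewrite lee_fin /Q0/= /b0 patchE mem_setE in_itv/=.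
  case: ifP => [/andP[t0 tT]|_]; last by rewrite mul0r mul0r normr0.
  rewrite indicE mem_setE in_itv/= -ler_norml.
  have [yK|Ky] := leP `|y| K; last by rewrite spsi.2 ?(ltW Ky)// mulr0 normr0.
  rewrite mulr1 (mulrC C) -mulrA normrM (normrM (b t)) (normrM (S _)).
  rewrite ler_wpM2l// (ger0_norm C0) /C ler_pM//.
  rewrite /S/= (max_r (ltW t0)).
  have := HBm t (ltW t0) (ltW tT); have := HBp t (ltW t0) (ltW tT).
  by case: ifP => _; lra.
have E0 : \int[(mu \x mu)%E]_(p in half_plane) Q p = \int[(mu \x mu)%E]_p Q0 p.
  have [mG G0] := graph_negligible mx0.
  rewrite Rintegral_mkcond; congr fine; apply: ae_eq_integral => //.
  - apply/measurable_EFinP; apply/(measurable_restrictT _ _).1 => //.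
    exact: measurableX.
  - exact/measurable_EFinP.
  exists [set p : R * R | p.1 = x0 p.2]; split => //.
  move=> [y t] /=; apply: contra_notP => yx _; congr EFin.
  rewrite patchE /Q0/= /b0 patchE mem_setE in_itv/=.
  have [t0|t0] := ltP 0 t; last first.
    rewrite memNset; last by move=> [_]; rewrite /= in_itv/= andbT ltNge t0.
    by rewrite (psiT y t) ?mulr0// => /andP[]; rewrite ltNge t0.
  rewrite mem_set; last by split => //; rewrite /= in_itv/= t0.
  rewrite Qeq//; last by move: yx; rewrite /x0 max_r// ltW.
  rewrite /S/= /x0 (max_r (ltW t0))/=.
  by have [//|tT] := ltP t T; rewrite psiT ?mulr0// => /andP[_]; rewrite ltNge tT.
rewrite E0 [RHS]Rintegral_mkcond /Rintegral -integral21_prod_meas1//.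
congr fine; apply: eq_integral => t _.
have fi := strip_integrable t spsi.
transitivity (\int[mu]_y (b0 t * ((if y < x0 t then Am (Num.max 0 t) else Ap (Num.max 0 t)) * psi y t))%:E)%E.
  by rewrite /fubini_G; apply: eq_integral => y _; rewrite /Q0 /S /= mulrA.
have si := step_integrable (x0 t) (Am (Num.max 0 t)) (Ap (Num.max 0 t)) fi.
rewrite -[LHS]fineK; last by apply: integrable_fin_num => //; exact: (integrableZl _ _ si).
rewrite -/(Rintegral mu setT _) RintegralZl// step_integral// -(left_mass_total t K0 spsi).
congr EFin; rewrite /b0 !patchE; case: ifPn => [|_]; last by rewrite mul0r.
rewrite inE/= in_itv/= => /andP[t0 tT].
by rewrite /x0 !(max_r (ltW t0)).
Qed.

End step_profiles.


(** * Smooth bumps *)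

Section bumps.
Context {R : realType}.
Notation mu := (@lebesgue_measure R).
Implicit Types (f g : R -> R) (p : {poly R}).

(** Converse of [derive_eps]. *)
Lemma is_derive_of_eps f (z df : R) : (forall e : R, 0 < e -> exists2 d : R, 0 < d &
  forall a : R, `|a - z| < d -> `|f a - f z - df * (a - z)| <= e * `|a - z|) ->
  is_derive z 1 f df.
Proof.
move=> H.
have C : h^-1 *: ((f \o shift z) (h *: 1) - f z) @[h --> 0^'] --> df.
  apply/cvgrPdist_le => e e0; have [d d0 Hd] := H e e0.
  apply/nbhs_ballP; exists d => //= h; rewrite /ball/= sub0r normrN => hd h0.
  have := Hd (h + z); rewrite addrK => /(_ hd).
  rewrite /GRing.scale/= mulr1 => K.
  have hp : 0 < `|h| by rewrite normr_gt0.
  rewrite -(ler_pM2r hp) -normrM.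
  rewrite (_ : _ * h = - (f (h + z) - f z - df * h)) ?normrN//.
  by field.
by apply: DeriveDef; [apply/cvg_ex; exists df|exact/cvg_lim].
Qed.

(** Products of exponentially small and polynomially large terms are bounded. *)
Lemma poly_expR_bounded p n :
  exists C, forall y : R, 0 <= y -> y ^+ n * `|p.[y]| * expR (- y) <= C.
Proof.
elim/poly_ind: p n => [|p c IH] n.
  by exists 0 => y _; rewrite horner0 normr0 mulr0 mul0r.
have [C HC] := IH n.+1.
exists (C + `|c| * n.+1`!%:R) => y y0; rewrite hornerMXaddC.
have e0 := expR_ge0 (- y); have yn := exprn_ge0 n y0.
have h1 : `|p.[y] * y + c| <= `|p.[y]| * y + `|c|.
  by rewrite (le_trans (ler_normD _ _))// normrM (ger0_norm y0).
have h2 : y ^+ n * expR (- y) <= n.+1`!%:R.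
  rewrite expRN ler_pdivrMr ?expR_gt0//.
  have f1 : (1 : R) <= n.+1`!%:R by rewrite ler1n fact_gt0.
  have := expR_ge1Dxn n y0; rewrite -lerBrDl ler_pdivrMr ?ltr0n ?fact_gt0// mulrC.
  have := expR_ge1Dx y; case: (leP y 1) => y1.
    by have : y ^+ n <= 1 by [exact: exprn_ile1]; nra.
  have : y ^+ n <= y ^+ n.+1 by rewrite exprS ler_peMl// ltW.
  nra.
apply: le_trans (lerD (HC y y0) (ler_wpM2l (normr_ge0 c) h2)).
rewrite exprS; have := mulr_ge0 yn e0; nra.
Qed.

(** The functions [p (1/x) exp (- 1/x)], extended by zero: all derivatives of
    the classical flat function have this form, hence the polynomial. *)
Definition flat p (x : R) := if 0 < x then p.[x^-1] * expR (- x^-1) else 0.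

(** At [0] the difference quotient is small because exponential decay beats
    every polynomial; elsewhere this is the usual computation. *)
Lemma is_derive_flat p (x : R) :
  is_derive x 1 (flat p) (flat ('X^2 * (p - p^`())) x).
Proof.
have [x0|x0] := ltP 0 x.
  have E : {near x, flat p =1 (fun x => p.[x^-1] * expR (- x^-1))}.
    near=> y; rewrite /flat ifT//; near: y; exact: lt_nbhsr.
  rewrite /flat x0.
  have dV : is_derive x 1 (fun y : R => y^-1) (- x ^- 2 *: (1 : R)).
    by apply: is_deriveV; exact: lt0r_neq0.
  have dP : is_derive x 1 (fun y => p.[y^-1]) (p^`().[x^-1] * (- x ^- 2 *: (1 : R))).
    exact: (@is_derive1_comp _ (horner p) (fun y => y^-1)).
  have dE : is_derive x 1 (fun y => expR (- y^-1)) (expR (- x^-1) * (- (- x ^- 2 *: (1 : R)))).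
    exact: (@is_derive1_comp _ expR (fun y => - y^-1)).
  have E' : {near x, (fun x => p.[x^-1] * expR (- x^-1)) =1 flat p}.
    by near do apply/esym.
  apply: (near_eq_is_derive E'); apply: (is_derive_eq (is_deriveM dP dE)).
  rewrite /GRing.scale/= !hornerE.
  rewrite [LHS](_ : _ = p.[x^-1] * expR (- x^-1) * (- - x ^- 2) +
     expR (- x^-1) * p^`().[x^-1] * (- x ^- 2))//.
  by field; exact: lt0r_neq0.
have [x1|x1] := ltP x 0.
  have E : {near x, flat p =1 cst 0}.
    near=> y; rewrite /flat ifF//; apply/negbTE; rewrite -leNgt ltW//; near: y; exact: lt_nbhsl.
  have E' : {near x, cst 0 =1 flat p} by near do apply/esym.
  rewrite /flat ltNge ltW//=; apply: (near_eq_is_derive E'); exact: is_derive_cst.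
have -> : x = 0 by lra.
have [C HC] := poly_expR_bounded p 2.
have C0 : 0 <= C by apply: le_trans (HC 0 (lexx 0)); rewrite expr0n mul0r mul0r.
apply: is_derive_of_eps => e e0.
exists (e / (C + 1)); first by rewrite divr_gt0//; lra.
move=> a; rewrite subr0 /flat ltxx mul0r !subr0; case: ifPn => [a0 ad|_ _]; last first.
  by rewrite normr0 mulr_ge0// ltW.
have a1 : 0 <= a^-1 by rewrite invr_ge0 ltW.
move: ad; rewrite ltr_pdivlMr; last by lra.
rewrite (gtr0_norm a0) => ad.
have := HC _ a1; rewrite normrM (ger0_norm (expR_ge0 _)) -mulrA.
rewrite exprVn ler_pdivrMl ?exprn_gt0// => /le_trans; apply.
by rewrite expr2 -mulrA mulrC ler_wpM2r// ?(ltW a0)//; nra.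
Unshelve. all: by end_near. Qed.

(** A class of functions that is closed under derivation, and hence consists of
    smooth functions, and that is rich enough to contain plateau functions. *)
Inductive smooth_alg : (R -> R) -> Prop :=
| sa_cst c : smooth_alg (cst c)
| sa_id : smooth_alg id
| sa_flat p : smooth_alg (flat p)
| sa_add f g : smooth_alg f -> smooth_alg g -> smooth_alg (fun x => f x + g x)
| sa_mul f g : smooth_alg f -> smooth_alg g -> smooth_alg (fun x => f x * g x)
| sa_affine f (a b : R) : smooth_alg f -> smooth_alg (fun x => f (a * x + b))
| sa_prim f df : smooth_alg df -> (forall x : R, is_derive x 1 f (df x)) ->
    smooth_alg f.

Lemma smooth_alg_derive f : smooth_alg f ->
  exists2 df, smooth_alg df & forall x : R, is_derive x 1 f (df x).
Proof.
elim=> {f}.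
- by move=> c; exists (cst 0); [exact: sa_cst|move=> x; exact: is_derive_cst].
- by exists (cst 1); [exact: sa_cst|move=> x; exact: is_derive_id].
- by move=> p; exists (flat ('X^2 * (p - p^`()))); [exact: sa_flat|exact: is_derive_flat].
- move=> f g _ [df fs Hf] _ [dg gs Hg].
  exists (fun x => df x + dg x); first exact: sa_add.
  by move=> x; exact: is_deriveD.
- move=> f g fs0 [df fs Hf] gs0 [dg gs Hg].
  exists (fun x => f x * dg x + g x * df x); first by apply: sa_add; exact: sa_mul.
  by move=> x; exact: is_deriveM.
- move=> f a b _ [df fs Hf]; exists (fun x => df (a * x + b) * a).
    by apply: sa_mul; [exact: sa_affine|exact: sa_cst].
  move=> x; apply: (@is_derive1_comp _ f (fun x => a * x + b)).
  have H := is_deriveD (is_deriveM (is_derive_cst a x 1) (is_derive_id x 1)) (is_derive_cst b x 1).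
  by apply: (is_derive_eq H); rewrite /GRing.scale/= mulr0 addr0 mulr1 addr0.
- by move=> f df dfs _ H; exists df.
Qed.

Lemma smooth_alg_cont f : smooth_alg f -> continuous f.
Proof.
move=> /smooth_alg_derive[df _ H] z.
by apply/differentiable_continuous/derivable1_diffP; case: (H z).
Qed.

Lemma is_derive_derive1 f df : (forall x : R, is_derive x 1 f (df x)) -> derive1 f = df.
Proof. by move=> H; apply/funext => x; rewrite derive1E; case: (H x). Qed.

Lemma dt_tensor f g dg : (forall t : R, is_derive t 1 g (dg t)) ->
  dt (fun y t => f y * g t) = fun y t => f y * dg t.
Proof.
move=> H; apply/funext => y; apply/funext => t; rewrite /dt derive1E.
have K := is_deriveM (is_derive_cst (f y) t 1) (H t).
by case: K => _ ->; rewrite /GRing.scale/= mulr0 addr0.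
Qed.

Lemma dx_tensor f df g : (forall y : R, is_derive y 1 f (df y)) ->
  dx (fun y t => f y * g t) = fun y t => df y * g t.
Proof.
move=> H; apply/funext => y; apply/funext => t; rewrite /dx derive1E.
have K := is_deriveM (H y) (is_derive_cst (g t) y 1).
by case: K => _ ->; rewrite /GRing.scale/= mulr0 add0r mulrC.
Qed.

(** Words of partial derivatives act separately on the two factors. *)
Lemma partial_tensor (s : seq bool) f g : smooth_alg f -> smooth_alg g ->
  exists fs gs, [/\ smooth_alg fs, smooth_alg gs &
    partial s (fun y t => f y * g t) = fun y t => fs y * gs t].
Proof.
move=> sf sg; elim: s => [|b s [fs [gs [Hf Hg /= ->]]]]; first by exists f, g.
case: b.
  by have [dg sdg Hdg] := smooth_alg_derive Hg; exists fs, dg; rewrite (dt_tensor _ Hdg).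
by have [df sdf Hdf] := smooth_alg_derive Hf; exists df, gs; rewrite (dx_tensor _ Hdf).
Qed.

Lemma test_function_tensor f g (K a b : R) : smooth_alg f -> smooth_alg g ->
  0 < a -> (forall y, K < `|y| -> f y = 0) -> (forall t, ~ (a <= t <= b) -> g t = 0) ->
  test_function (fun y t => f y * g t).
Proof.
move=> sf sg a0 f0 g0.
have sub : closure [set p : R * R | f p.1 * g p.2 != 0] `<=` `[(- K), K]%classic `*` `[a, b]%classic.
  have cbox : compact (`[(- K), K]%classic `*` `[a, b]%classic : set (R * R)).
    by apply: compact_setX; exact: segment_compact.
  have := compact_closed (@norm_hausdorff _ _) cbox.
  move=> /closure_id ->; apply: closureS => -[y t] /=.
  rewrite mulf_eq0 negb_or => /andP[fy gt]; split=> /=; rewrite in_itv/=.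
    by rewrite -ler_norml leNgt; apply: contra fy => /f0 ->.
  by apply: contraNT gt => /negP /g0 ->.
split.
- move=> s; have [fs [gs [Hf Hg ->]]] := partial_tensor s sf sg.
  have [df _ Hdf] := smooth_alg_derive Hf; have [dg _ Hdg] := smooth_alg_derive Hg.
  split.
  + move=> p; apply: cvgM.
      by apply: (@continuous_comp _ _ _ fst fs); [exact: cvg_fst|exact: smooth_alg_cont].
    by apply: (@continuous_comp _ _ _ snd gs); [exact: cvg_snd|exact: smooth_alg_cont].
  + by move=> x t; case: (is_deriveM (Hdf x) (is_derive_cst (gs t) x 1)).
  + by move=> x t; case: (is_deriveM (is_derive_cst (fs x) t 1) (Hdg t)).
- apply: (subclosed_compact _ _ sub); first exact: closed_closure.
  by apply: compact_setX; exact: segment_compact.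
- by move=> p /sub [_ /=]; rewrite in_itv/= => /andP[/(lt_le_trans a0)].
Qed.

Lemma derivable1n_smooth_alg f : smooth_alg f -> forall n (x : R), derivable (derive1n n f) x 1.
Proof.
move=> sf n; have [g sg ->] : exists2 g, smooth_alg g & derive1n n f = g.
  elim: n => [|n [g sg IH]]; first by exists f.
  have [dg sdg Hdg] := smooth_alg_derive sg.
  by exists dg => //=; rewrite IH; exact: is_derive_derive1.
by move=> x; have [dg _ H] := smooth_alg_derive sg; case: (H x).
Qed.

Definition bump (x : R) := flat 1 (1 + x) * flat 1 (1 - x).

Lemma smooth_bump : smooth_alg bump.
Proof.
rewrite (_ : bump = fun x => flat 1 (1 * x + 1) * flat 1 (-1 * x + 1)).
  by apply: sa_mul; apply: sa_affine; exact: sa_flat.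
by apply/funext => x; rewrite /bump mul1r mulN1r addrC (addrC 1 (- x)).
Qed.

Lemma flat1_ge0_le1 (x : R) : 0 <= flat 1 x <= 1.
Proof.
rewrite /flat; case: ifPn => x0; last by rewrite lexx ler01.
by rewrite hornerC mul1r expR_ge0 -expR0 ler_expR oppr_le0 invr_ge0 ltW.
Qed.

Lemma bump_ge0 x : 0 <= bump x.
Proof. by have /andP[? _] := flat1_ge0_le1 (1 + x); have /andP[? _] := flat1_ge0_le1 (1 - x); exact: mulr_ge0. Qed.

Lemma bump_le1 x : bump x <= 1.
Proof.
have /andP[? ?] := flat1_ge0_le1 (1 + x); have /andP[? ?] := flat1_ge0_le1 (1 - x).
by rewrite /bump -[leRHS](mulr1 1) ler_pM.
Qed.

Lemma bump_out x : 1 <= `|x| -> bump x = 0.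
Proof.
rewrite ler_normr /bump /flat => /orP[h|h].
  by rewrite [X in _ * X]ifF ?mulr0//; apply/negbTE; rewrite -leNgt; lra.
by rewrite [X in X * _]ifF ?mul0r//; apply/negbTE; rewrite -leNgt; lra.
Qed.

Lemma bump0_gt0 : 0 < bump 0.
Proof.
by rewrite /bump /flat addr0 subr0 ltr01 hornerC mul1r mulr_gt0// expR_gt0.
Qed.

Definition rise (x : R) := \int[mu]_(y in `]-oo, x]) bump y.

Lemma strip_bump : strip 1 (fun y _ : R => bump y).
Proof.
split=> [|y _]; last exact: bump_out.
move=> p; apply: (@continuous_comp _ _ _ fst bump); first exact: cvg_fst.
exact/smooth_alg_cont/smooth_bump.
Qed.

Lemma is_derive_rise (x : R) : is_derive x 1 rise (bump x).
Proof. exact: (left_mass_derive x 0 strip_bump). Qed.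

Lemma smooth_rise : smooth_alg rise.
Proof. by apply: sa_prim is_derive_rise; exact: smooth_bump. Qed.

Lemma rise_left x : x <= -1 -> rise x = 0.
Proof. by move=> x1; exact: (left_mass_far 0 strip_bump). Qed.

Lemma rise_right x : 1 <= x -> rise x = rise 1.
Proof.
move=> x1; have h := left_mass_total 0 ler01 strip_bump.
have strip_x : strip x (fun y _ : R => bump y).
  by split; [exact: strip_bump.1|move=> y _ yx; rewrite bump_out// (le_trans x1)].
have x0 : 0 <= x by lra.
have := left_mass_total 0 x0 strip_x; rewrite /rise /left_mass in h * => ->.
by rewrite h.
Qed.

Lemma rise_nondecreasing x y : x <= y -> rise x <= rise y.
Proof.
move=> xy; have [c _] := mean_value x y is_derive_rise.
have := bump_ge0 c; nra.
Qed.

(** Otherwise [rise], being monotone, would vanish identically, against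
    [bump 0 > 0]. *)
Lemma rise1_gt0 : 0 < rise 1.
Proof.
have r0 : 0 <= rise 1 by rewrite -(@rise_left (-1))//; apply: rise_nondecreasing; lra.
rewrite lt_neqAle r0 andbT; apply/eqP => r1.
have z x : rise x = 0.
  apply/eqP; rewrite eq_le; apply/andP; split.
    have [x1|/ltW x1] := leP 1 x; first by rewrite rise_right// r1.
    by rewrite r1; exact: rise_nondecreasing.
  have [x1|/ltW x1] := leP x (-1); first by rewrite rise_left.
  by rewrite -(@rise_left (-1))//; exact: rise_nondecreasing.
have := bump0_gt0; case: (is_derive_rise 0) => _ <-.
by rewrite -derive1E near0_derive1 ?ltxx//; exact: filterE.
Qed.

Definition plateau (M x : R) := (rise (x + (M + 1)) - rise (x - (M + 1))) / rise 1.

Lemma smooth_plateau M : smooth_alg (plateau M).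
Proof.
rewrite (_ : plateau M = fun x => (rise (1 * x + (M + 1)) + (-1) * rise (1 * x + - (M + 1))) * (rise 1)^-1).
  apply: sa_mul; last exact: sa_cst.
  apply: sa_add; first exact/sa_affine/smooth_rise.
  by apply: sa_mul; [exact: sa_cst|exact/sa_affine/smooth_rise].
by apply/funext => x; rewrite /plateau !mul1r mulN1r.
Qed.

Lemma plateau_in M x : `|x| <= M -> plateau M x = 1.
Proof.
rewrite ler_norml => /andP[h1 h2]; rewrite /plateau rise_right; last by lra.
by rewrite (@rise_left (x - (M + 1))) ?subr0 //; [|lra]; rewrite divff// gt_eqF// rise1_gt0.
Qed.

Lemma plateau_out M x : 0 <= M -> M + 2 <= `|x| -> plateau M x = 0.
Proof.
move=> M0; rewrite ler_normr /plateau => /orP[h|h].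
  by rewrite !rise_right ?subrr ?mul0r//; lra.
by rewrite (@rise_left (x + _)) ?(@rise_left (x - _)) ?subrr ?mul0r//; lra.
Qed.

Lemma primitive_C1 f df : (forall x : R, is_derive x 1 f (df x)) -> continuous df ->
  primitive f df.
Proof.
move=> fdf cdf.
apply: (@eq_primitive _ _ (fun t => df t * 1 + 0 * 0)).
  by move=> t; rewrite mulr1 mulr0 addr0.
apply: (@primitive_chain _ (fun a _ => f a) _ (fun=> 0) id _ (fun=> 0) (fun=> 0)).
- exact: primitive_id.
- exact: primitive_cst.
- move=> t; apply: continuous_comp; last exact: cdf.
  exact: (primitive_cont0 primitive_id).
- by move=> t; exact: cvg_cst.
move=> t e t0 e0; have [d d0 Hd] := derive_eps (fdf t) e0.
exists d => // a b at' _; rewrite mul0r addr0.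
by apply: (le_trans (Hd _ at')); rewrite ler_pM2l// lerDl.
Qed.

(** * Spikes and weak derivatives *)

(** As [e] decreases to [0], [spike_at t e] tends to a multiple of the Dirac mass
    at [t].  The mass [rise 1] is not normalised to [1]. *)
Definition step_at (t e s : R) := rise (e^-1 * s + - (e^-1 * t)).
Definition spike_at (t e s : R) := bump (e^-1 * s + - (e^-1 * t)) * e^-1.

Lemma smooth_step_at t e : smooth_alg (step_at t e).
Proof. exact/sa_affine/smooth_rise. Qed.

Lemma smooth_spike_at t e : smooth_alg (spike_at t e).
Proof. by apply: sa_mul; [exact/sa_affine/smooth_bump|exact: sa_cst]. Qed.

Lemma is_derive_step_at t e (s : R) : is_derive s 1 (step_at t e) (spike_at t e s).
Proof.
apply: (@is_derive1_comp _ rise (fun s => e^-1 * s + - (e^-1 * t))).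
  exact: is_derive_rise.
have H := is_deriveD (is_deriveM (is_derive_cst e^-1 s 1) (is_derive_id s 1)) (is_derive_cst (- (e^-1 * t)) s 1).
by apply: (is_derive_eq H); rewrite /GRing.scale/= mulr0 addr0 mulr1 addr0.
Qed.

Lemma spike_out t e s : 0 < e -> e <= `|s - t| -> spike_at t e s = 0.
Proof.
move=> e0 est; rewrite /spike_at bump_out ?mul0r// -mulrBr normrM.
by rewrite gtr0_norm ?invr_gt0// ler_pdivlMl// mulr1.
Qed.

Lemma step_left t e s : 0 < e -> s <= t - e -> step_at t e s = 0.
Proof.
move=> e0 est; rewrite /step_at rise_left// -mulrBr.
by rewrite ler_pdivrMl//; lra.
Qed.

Lemma step_right t e s : 0 < e -> t + e <= s -> step_at t e s = rise 1.
Proof.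
move=> e0 est; rewrite /step_at rise_right// -mulrBr.
by rewrite ler_pdivlMl//; lra.
Qed.

Lemma spike_bound t e s : 0 < e -> 0 <= spike_at t e s <= e^-1.
Proof.
move=> e0; rewrite /spike_at; have e1 : 0 <= e^-1 by rewrite invr_ge0 ltW.
by rewrite mulr_ge0 ?bump_ge0//= ler_piMl ?bump_le1.
Qed.

Lemma Rintegral_oo_cc f (T : R) : L1loc f -> 0 < T ->
  \int[mu]_(s in `]0, T[) f s = \int[mu]_(s in `[0, T]) f s.
Proof.
move=> fL T0; have fi := L1loc_itv T fL (lexx 0).
rewrite Rintegral_itv_bndo_bndc; last exact: fL.
rewrite Rintegral_itv_obnd_cbnd//.
apply: (@integrableS _ _ _ mu `[0, T]%classic) => //.
by apply: subset_itvr; rewrite bnd_simp.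
Qed.

Lemma cont_cont0 f : continuous f -> cont0 f.
Proof.
move=> cf t; apply: continuous_comp; last exact: cf.
exact: (primitive_cont0 primitive_id).
Qed.

Lemma spike_mass (T t e : R) : 0 < e -> 0 < t - e -> t + e < T ->
  \int[mu]_(s in `]0, T[) spike_at t e s = rise 1.
Proof.
move=> e0 te tT; have T0 : 0 < T by lra.
have cs := smooth_alg_cont (smooth_spike_at t e).
have P := primitive_C1 (is_derive_step_at t e) cs.
rewrite Rintegral_oo_cc//; last by case: P.
rewrite -(primitiveB P (lexx 0) (ltW T0)) step_right ?step_left ?subr0//; lra.
Qed.

(** At a Lebesgue point, integrals against spikes recover the value. *)
Lemma spike_lebesgue_pt g (T t d : R) : L1loc g -> 0 < t < T ->
  lebesgue_pt (g \_ `]0, T[) t -> 0 < d ->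
  \forall e \near 0^'+, [/\ 0 < t - e, t + e < T &
   `|\int[mu]_(s in `]0, T[) (g s * spike_at t e s) - rise 1 * g t| <= d].
Proof.
set q := g \_ _; move=> gL /andP[t0 tT] tleb d0.
have /fine_cvgP[davg_fin /cvgrPdist_le/(_ (d / 2) (divr_gt0 d0 (ltr0n _ 2))) davg_le] := tleb.
near=> e.
have e0 : 0 < e by near: e; exact: nbhs_right_gt.
have et : e < t by near: e; exact: nbhs_right_lt.
have eT : e < T - t by near: e; apply: nbhs_right_lt; rewrite subr_gt0.
have te0 : 0 < t - e by lra.
have teT : t + e < T by lra.
split => //.
have dfin : davg q t e \is a fin_num by near: e.
have dle : `|0 - fine (davg q t e)| <= d / 2 by near: e.
have {}dle : (davg q t e <= (d / 2)%:E)%E.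
  by rewrite -(fineK dfin) lee_fin; move: dle; rewrite sub0r normrN; exact/le_trans/ler_norm.
have T0 : 0 < T by lra.
have cs := cont_cont0 (smooth_alg_cont (smooth_spike_at t e)).
have mT : measurable (`]0, T[%classic : set R) by [].
have i1 := L1locM gL cs T0; have i2 := L1locZ (g t) (cont0_L1loc cs) T0.
rewrite -(spike_mass e0 te0 teT) mulrC -RintegralZl//; last exact: (cont0_L1loc cs T0).
rewrite -RintegralB//.
have i3 : mu.-integrable `]0, T[ (EFin \o (fun s => g s * spike_at t e s - g t * spike_at t e s)).
  exact: (integrableB _ i1 i2).
apply: (le_trans (le_normr_Rintegral _ _)) => //.
rewrite -lee_fin /Rintegral fineK; last first.
  by apply: integrable_fin_num => //; exact: (integrable_norm i3).
have e20 : 0 < e *+ 2 by rewrite mulrn_wgt0.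
have muV : ((mu (ball t e))^-1 = ((e *+ 2)^-1)%:E)%E.
  by rewrite lebesgue_measure_ball ?ltW//=; rewrite inver gt_eqF.
move: dle; rewrite /davg /iavg muV lee_pdivrMl// => dle.
have mb : measurable (ball t e : set R) by exact: measurable_ball.
have mq : measurable_fun [set: R] q.
  by apply/(measurable_restrictT _ _).1 => //; apply/measurable_EFinP; exact: measurable_int (gL _ T0).
apply: (@le_trans _ _ (\int[mu]_(y in ball t e) ((e^-1)%:E * `|((center (q t) \o q) y)%:E|))%E); last first.
  rewrite ge0_integralZl//; last 2 first.
  - by apply/measurable_EFinP; apply: measurableT_comp => //; apply: measurable_funTS; exact: measurable_funB.
  - by rewrite lee_fin invr_ge0 ltW.
  rewrite lee_pdivrMl//; apply: (le_trans dle); rewrite -!EFinM lee_fin; lra.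
rewrite integral_mkcond [leRHS]integral_mkcond; apply: ge0_le_integral => //.
- by move=> y _; rewrite patchE; case: ifP => // _; rewrite lee_fin.
- apply/(measurable_restrictT _ _).1 => //; apply/measurable_EFinP.
  by apply: measurableT_comp => //; apply/measurable_EFinP; exact: measurable_int i3.
- apply/(measurable_restrictT _ _).1 => //; apply/measurable_EFinP.
  apply: measurable_funM => //; apply: measurableT_comp => //.
  by apply: measurable_funTS; exact: measurable_funB.
move=> y _; move: (y : R) => {}y; rewrite !patchE.
have qt : q t = g t by rewrite /q patchE mem_setE in_itv/= t0 tT.
have /andP[s0 s1] := spike_bound t y e0.
have [yb|yb] := ltP `|t - y| e.
  have yT : 0 < y < T by move: yb; rewrite ltr_norml; lra.
  rewrite mem_set; last by rewrite /= in_itv.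
  rewrite mem_set// /= lee_fin -mulrBl normrM mulrC ler_pM// ?(ger0_norm s0)//.
  by rewrite qt /q patchE mem_setE in_itv/= yT.
rewrite distrC in yb; rewrite (spike_out e0 yb) !mulr0 subrr normr0.
rewrite [X in (_ <= X)%E]ifF; first by case: ifP.
by apply/negbTE/negP; rewrite inE /ball/= distrC ltNge yb.
Unshelve. all: by end_near. Qed.

Lemma ae_imp (P Q : R -> Prop) : (forall t, P t -> Q t) ->
  {ae mu, forall t, P t} -> {ae mu, forall t, Q t}.
Proof.
by move=> PQ; apply: filterS => //; exact: (ae_filter_ringOfSetsType mu).
Qed.

Lemma ae_imp2 (P P' Q : R -> Prop) : (forall t, P t -> P' t -> Q t) ->
  {ae mu, forall t, P t} -> {ae mu, forall t, P' t} -> {ae mu, forall t, Q t}.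
Proof.
by move=> PQ; apply: filterS2 => //; exact: (ae_filter_ringOfSetsType mu).
Qed.

Lemma ae_exists (P : R -> Prop) (a b : R) : a < b -> {ae mu, forall t, P t} ->
  exists2 r, a < r < b & P r.
Proof.
move=> ab [A [mA A0 PA]]; apply: contrapT => H.
have sA : `]a, b[%classic `<=` A.
  move=> r /=; rewrite in_itv/= => rab; apply: PA => Pr; apply: H; by exists r.
have : (mu (`]a, b[%classic : set R) <= mu A)%E.
  by apply: le_measure => //; rewrite inE.
rewrite A0 lebesgue_measure_itv/= lte_fin ab -EFinB lee_fin; lra.
Qed.

Lemma Rintegral_oy f (T : R) : (forall t, T <= t -> f t = 0) ->
  \int[mu]_(s in `]0, +oo[) f s = \int[mu]_(s in `]0, T[) f s.
Proof.
move=> fT; rewrite Rintegral_mkcond [RHS]Rintegral_mkcond; apply: eq_Rintegral => t _.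
rewrite !patchE !mem_setE !in_itv/= andbT; case: ltP => //= t0.
by case: ltP => // tT; rewrite fT.
Qed.

Lemma integrable_oy f (T : R) : (forall t, T <= t -> f t = 0) ->
  mu.-integrable `]0, T[ (EFin \o f) -> mu.-integrable `]0, +oo[ (EFin \o f).
Proof.
move=> fT fi; apply/integrable_mkcond => //.
apply: eq_integrable (proj1 (integrable_mkcond _ _) fi) => // t _.
rewrite !patchE !mem_setE !in_itv/= andbT; case: ltP => //= t0.
by case: ltP => // tT; rewrite fT.
Qed.

Definition spike_limit g (t : R) := forall d : R, 0 < d ->
  \forall e \near 0^'+, 0 < t - e /\
   `|\int[mu]_(s in `]0, +oo[) (g s * spike_at t e s) - rise 1 * g t| <= d.

Lemma spike_cut g (t e s T : R) : 0 < e -> t + e <= T -> T <= s -> g s * spike_at t e s = 0.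
Proof. by move=> e0 teT Ts; rewrite spike_out ?mulr0// ger0_norm; lra. Qed.

Lemma ae_lebesgue_pt f : L1loc f ->
  {ae mu, forall t, forall n : nat, lebesgue_pt (f \_ `]0, n.+1%:R[) t}.
Proof.
move=> fL; apply: ae_foralln => n; apply: lebesgue_differentiation.
apply: open_integrable_locally; first exact: openT.
by rewrite -restrict_EFin; apply: (proj1 (integrable_mkcond _ _)) => //; exact: fL.
Qed.

Lemma ae_spike_limit g : L1loc g ->
  {ae mu, forall t, 0 < t -> spike_limit g t}.
Proof.
move=> gL.
apply: (ae_imp _ (ae_lebesgue_pt gL)) => t Ht t0 d d0.
have tn : t < (Num.bound t).+1%:R.
  have := archi_boundP (ltW t0); rewrite -natr1; lra.
have := spike_lebesgue_pt gL (introT andP (conj t0 tn)) (Ht _) d0.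
move=> near_e; near=> e.
have e0 : 0 < e by near: e; exact: nbhs_right_gt.
have [h1 h2 h3] : [/\ 0 < t - e, t + e < (Num.bound t).+1%:R &
   `|\int[mu]_(s in `]0, (Num.bound t).+1%:R[) (g s * spike_at t e s) - rise 1 * g t| <= d] by near: e.
split=> //; rewrite (@Rintegral_oy _ (Num.bound t).+1%:R)// => s Ts.
exact: spike_cut (ltW h2) Ts.
Unshelve. all: by end_near. Qed.

(** Smooth functions with compact support in [`]0, +oo[], together with their
    derivative; [0 < a] keeps the support away from the initial time. *)
Definition time_test (a b : R) (eta deta : R -> R) :=
  [/\ smooth_alg eta, smooth_alg deta, (forall t : R, is_derive t 1 eta (deta t)),
   0 < a & forall t, ~ (a <= t <= b) -> eta t = 0 /\ deta t = 0].

Lemma time_test_steps (t r e : R) : 0 < e -> 0 < t - e -> 0 < r - e ->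
  time_test (Num.min t r - e) (Num.max t r + e)
    (fun s => step_at t e s - step_at r e s) (fun s => spike_at t e s - spike_at r e s).
Proof.
move=> e0 te re; split.
- rewrite (_ : (fun s => _) = fun s => step_at t e s + (-1) * step_at r e s).
    apply: sa_add; first exact: smooth_step_at.
    by apply: sa_mul; [exact: sa_cst|exact: smooth_step_at].
  by apply/funext => s; rewrite mulN1r.
- rewrite (_ : (fun s => _) = fun s => spike_at t e s + (-1) * spike_at r e s).
    apply: sa_add; first exact: smooth_spike_at.
    by apply: sa_mul; [exact: sa_cst|exact: smooth_spike_at].
  by apply/funext => s; rewrite mulN1r.
- by move=> s; apply: is_deriveB; exact: is_derive_step_at.
- by rewrite subr_gt0 lt_min -!(subr_gt0 e) te.
have m1 : Num.min t r <= t by rewrite ge_min lexx.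
have m2 : Num.min t r <= r by rewrite ge_min lexx orbT.
have M1 : t <= Num.max t r by rewrite le_max lexx.
have M2 : r <= Num.max t r by rewrite le_max lexx orbT.
move: m1 m2 M1 M2; move: (Num.min t r) (Num.max t r) => m M m1 m2 M1 M2 s sout.
have [sm|ms] := ltP s (m - e).
  rewrite !step_left ?subrr; [|lra..].
  by rewrite !spike_out ?subrr// ler0_norm; lra.
have {sout ms} sM : M + e < s.
  by rewrite ltNge; apply/negP => sM; apply: sout; rewrite ms.
rewrite !step_right ?subrr; [|lra..].
by rewrite !spike_out ?subrr// ger0_norm; lra.
Qed.

(** A function with zero weak derivative is constant: test against the
    difference of two steps. *)
Lemma weakly_constant g : L1loc g ->
  (forall a b eta deta, time_test a b eta deta ->
     \int[mu]_(t in `]0, +oo[) (g t * deta t) = 0) ->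
  exists C, {ae mu, forall t, 0 < t -> g t = C}.
Proof.
move=> gL H; have Hae := ae_spike_limit gL.
have [r /andP[r0 _] /(_ r0) Hr] := ae_exists ltr01 Hae.
exists (g r); apply: (ae_imp _ Hae) => t Ht t0; have {}Ht := Ht t0.
apply/eqP; rewrite -subr_eq0 -normr_le0 -(ler_pM2l rise1_gt0) mulr0; apply/ler_addgt0Pr => d d0.
have d20 : 0 < d / 2 by lra.
have := Ht _ d20 => {}Ht; have := Hr _ d20 => {}Hr.
near (0 : R)^'+ => e.
have e0 : 0 < e by near: e; exact: nbhs_right_gt.
have [te0 Et] : 0 < t - e /\
   `|\int[mu]_(s in `]0, +oo[) (g s * spike_at t e s) - rise 1 * g t| <= d / 2 by near: e.
have [re0 Er] : 0 < r - e /\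
   `|\int[mu]_(s in `]0, +oo[) (g s * spike_at r e s) - rise 1 * g r| <= d / 2 by near: e.
have si z : mu.-integrable `]0, +oo[ (EFin \o (fun s => g s * spike_at z e s)).
  have z0 : 0 < `|z| + e by rewrite ltr_wpDl.
  apply: (@integrable_oy _ (`|z| + e)).
    by move=> s; apply: spike_cut => //; have := ler_norm z; lra.
  exact: (L1locM gL (cont_cont0 (smooth_alg_cont (smooth_spike_at z e))) z0).
have tt := time_test_steps e0 te0 re0.
have := H _ _ _ _ tt; under eq_Rintegral do rewrite mulrBr.
rewrite RintegralB// => /eqP; rewrite subr_eq0 => /eqP E.
rewrite -[X in X * _](gtr0_norm rise1_gt0) -normrM mulrBr add0r.
rewrite (_ : _ - _ = (\int[mu]_(s in `]0, +oo[) (g s * spike_at r e s) - rise 1 * g r) -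
  (\int[mu]_(s in `]0, +oo[) (g s * spike_at t e s) - rise 1 * g t)); last by rewrite E; ring.
by rewrite (le_trans (ler_normB _ _))// [leRHS](splitr d) lerD.
Unshelve. all: by end_near. Qed.

End bumps.


(** * The weak equations of a delta shock *)

Section weak_equations.
Context {R : realType}.
Notation mu := (@lebesgue_measure R).
Implicit Types (f g x v w : R -> R) (phi psi : R -> R -> R).

Lemma test_function_bounded (s : seq bool) phi : test_function phi ->
  exists M : R, forall y t, `|partial s phi y t| <= M.
Proof.
move=> tf; have [K [T [K0 T0 supp]]] := test_function_box tf.
have [sm _ _] := tf; have [cs _ _] := sm s.
have cbox : compact (`[(- K), K]%classic `*` `[0, T]%classic : set (R * R)).
  by apply: compact_setX; exact: segment_compact.
have := continuous_compact (continuous_subspaceT cs) cbox.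
move=> /compact_bounded/ex_strict_bound_gt0[M M0 HM].
exists M => y t; have [h|h] := pselect (`|y| < K /\ 0 < t < T).
  apply/ltW/HM; exists (y, t) => //=; case: h => yK /andP[t0 tT].
  by split; rewrite /= in_itv/= -?ler_norml ?(ltW yK) ?(ltW t0) ?(ltW tT).
by rewrite supp// normr0 ltW.
Qed.

(** What the balance laws use of a test function.  Bounds on second derivatives
    are needed to differentiate masses in time. *)
Record admissible (K T M : R) phi := Admissible {
  adm_strip : forall s, strip K (partial s phi);
  adm_bound : forall s, (size s <= 2)%N -> forall y t, `|partial s phi y t| <= M;
  adm_time : forall s y t, ~ (0 < t < T) -> partial s phi y t = 0;
  adm_dt : forall s (y t : R), is_derive t 1 (partial s phi y) (dt (partial s phi) y t);
  adm_dx : forall s (y t : R), is_derive y 1 (partial s phi ^~ t) (dx (partial s phi) y t) }.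

Lemma test_function_admissible phi : test_function phi ->
  exists K T M, [/\ 0 < K, 0 < T & admissible K T M phi].
Proof.
move=> tf; have [K [T [K0 T0 supp]]] := test_function_box tf.
have /choice[M HM] := fun s => test_function_bounded s tf.
pose b := [:: true; false].
pose words := [:: [::]] ++ [seq [:: i] | i <- b] ++ [seq [:: i; j] | i <- b, j <- b].
exists K, T, (\sum_(s <- words) `|M s|); split => //.
have [sm _ _] := tf.
split=> [s|s s2 y t|s y t h|s y t|s y t].
- split; first by case: (sm s).
  by move=> y t Ky; apply: supp => -[]; rewrite ltNge Ky.
- apply: (le_trans (HM s y t)); apply: (le_trans (ler_norm _)).
  have sw : s \in words by case: s s2 => [|[] [|[] []]].
  rewrite (big_rem _ sw)/= lerDl; exact: sumr_ge0.
- by apply: supp => -[_].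
- by case: (sm s) => _ _ /(_ y t) d; apply: DeriveDef => //; rewrite /dt derive1E.
- by case: (sm s) => _ /(_ y t) d _; apply: DeriveDef => //; rewrite /dx derive1E.
Qed.

Section balance.
Variables (K T M : R) (phi : R -> R -> R).
Hypotheses (K0 : 0 < K) (T0 : 0 < T) (adm : admissible K T M phi).
Let Kge0 : 0 <= K := ltW K0.

Definition time_integral (f : R -> R) := \int[mu]_(t in `]0, T[) f t.

Lemma time_integralE f : (forall t, T <= t -> f t = 0) -> \int[mu]_(t in `]0, +oo[) f t = time_integral f.
Proof. exact: Rintegral_oy. Qed.

Lemma time_integralD f g : L1loc f -> L1loc g -> time_integral (fun t => f t + g t) = time_integral f + time_integral g.
Proof. by move=> fL gL; rewrite /time_integral RintegralD//; [exact: fL|exact: gL]. Qed.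

Lemma time_integralZ (c : R) f : L1loc f -> time_integral (fun t => c * f t) = c * time_integral f.
Proof. by move=> fL; rewrite /time_integral RintegralZl//; exact: fL. Qed.

(** Linearity for a formal combination of integrable functions, so that the weak
    equations are compared coefficient by coefficient. *)
Lemma time_integral_linear (s : seq (R * (R -> R))) f :
  foldr (fun p P => L1loc p.2 /\ P) True s ->
  (forall t, f t = foldr (fun p z => p.1 * p.2 t + z) 0 s) ->
  time_integral f = foldr (fun p z => p.1 * time_integral p.2 + z) 0 s.
Proof.
move=> sL /funext ->.
suff [] : L1loc (fun t => foldr (fun p z => p.1 * p.2 t + z) 0 s) /\
    time_integral (fun t => foldr (fun p z => p.1 * p.2 t + z) 0 s) =
    foldr (fun p z => p.1 * time_integral p.2 + z) 0 s by [].
elim: s sL => [_|[c g] s IH /= [gL /IH[hL hE]]].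
  by split; [exact: L1loc_cst|rewrite /time_integral Rintegral_cst// mul0r].
split; first by apply: L1locD => //; exact: L1locZ.
by rewrite time_integralD ?time_integralZ ?hE//; exact: L1locZ.
Qed.

Lemma time_integral_primitive F f : primitive F f -> F 0 = F T -> time_integral f = 0.
Proof.
move=> Ff F0T; have [fL _] := Ff.
by rewrite /time_integral Rintegral_oo_cc// -(primitiveB Ff (lexx 0) (ltW T0)) F0T subrr.
Qed.

Lemma adm_end0 s y : partial s phi y 0 = 0.
Proof. by rewrite (adm_time adm)// ltxx. Qed.

Lemma adm_endT s y t : T <= t -> partial s phi y t = 0.
Proof. by move=> Tt; apply: (adm_time adm) => /andP[_]; rewrite ltNge Tt. Qed.

Lemma left_mass_end0 s z : left_mass (partial s phi) z 0 = 0.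
Proof.
rewrite /left_mass (@eq_Rintegral _ _ _ _ _ (cst 0)) ?Rintegral_cst ?mul0r//.
by move=> y _; exact: adm_end0.
Qed.

Lemma left_mass_endT s z t : T <= t -> left_mass (partial s phi) z t = 0.
Proof.
move=> Tt; rewrite /left_mass (@eq_Rintegral _ _ _ _ _ (cst 0)) ?Rintegral_cst ?mul0r//.
by move=> y _; exact: adm_endT.
Qed.

Lemma adm_left_mass_dx z t : left_mass (dx phi) z t = phi z t.
Proof.
apply: (left_mass_dx Kge0 _ _ (adm_strip adm [::]) (adm_strip adm [:: false])).
exact: (adm_dx adm [::]).
Qed.

Lemma adm_primitive_left_mass x v : primitive x v ->
  primitive (fun t => left_mass phi (x t) t)
    (fun t => phi (x t) t * v t + left_mass (dt phi) (x t) t).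
Proof.
apply: (primitive_left_mass Kge0 (adm_strip adm [::]) (adm_strip adm [:: true])
  (adm_dt adm [::]) (adm_dt adm [:: true])
  (adm_bound adm (_ : size [:: true] <= 2)%N) (adm_bound adm (_ : size [:: true; true] <= 2)%N)) => //.
Qed.

Lemma adm_primitive_comp x v : primitive x v ->
  primitive (fun t => phi (x t) t)
    (fun t => dx phi (x t) t * v t + dt phi (x t) t).
Proof.
exact: (@primitive_comp _ phi (dx phi) (dt phi) _ _ (adm_dx adm [::])
  (adm_dt adm [::]) (adm_strip adm [:: false]).1 (adm_strip adm [:: true]).1).
Qed.

Lemma adm_cont0 s x : cont0 x -> cont0 (fun t => partial s phi (x t) t).
Proof.
move=> cx; exact: (continuous_along (adm_strip adm s).1 cx (primitive_cont0 primitive_id)).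
Qed.

(** The integrand is the derivative of [f * phi] along the curve, which vanishes
    at both ends. *)
Lemma transport_identity x v f df : primitive x v -> primitive f df ->
  time_integral (fun t => df t * phi (x t) t + f t * (dx phi (x t) t * v t + dt phi (x t) t)) = 0.
Proof.
move=> xv fdf; apply: (time_integral_primitive (primitiveM fdf (adm_primitive_comp xv))).
by rewrite [phi _ 0](adm_end0 [::]) [phi _ T](adm_endT [::])// !mulr0.
Qed.

(** The same for the mass to the left of the curve. *)
Lemma left_mass_identity x v f df : primitive x v -> primitive f df ->
  time_integral (fun t => df t * left_mass phi (x t) t +
     f t * (phi (x t) t * v t + left_mass (dt phi) (x t) t)) = 0.
Proof.
move=> xv fdf; apply: (time_integral_primitive (primitiveM fdf (adm_primitive_left_mass xv))).
by rewrite [left_mass phi _ 0](left_mass_end0 [::]) [left_mass phi _ T](left_mass_endT [::])// !mulr0.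
Qed.

(** The regular part of a pairing, for a density and a velocity which jump
    across the curve. *)
Lemma pairing_step (rhohat u : R -> R -> R) x w (ud b G Am Ap : R -> R) (s : seq bool) :
  L1loc b -> cont0 x -> cont0 Am -> cont0 Ap ->
  measurable_fun (@half_plane R) (fun p : R * R => rhohat p.1 p.2) ->
  measurable_fun (@half_plane R) (fun p : R * R => u p.1 p.2) ->
  measurable_fun [set: R] G -> (size s <= 2)%N ->
  (forall y t : R, 0 < t -> y <> x t ->
    rhohat y t * G (u y t) = if y < x t then Am t else Ap t) ->
  pairing rhohat u x w ud b G (partial s phi) =
  time_integral (fun t => b t * (Am t * left_mass (partial s phi) (x t) t +
     Ap t * (left_mass (partial s phi) K t - left_mass (partial s phi) (x t) t))) +
  time_integral (fun t => b t * w t * G (ud t) * partial s phi (x t) t).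
Proof.
move=> bL xc Amc Apc mr mU mG s2 jump; rewrite /pairing; congr (_ + _); last first.
  rewrite /weighted_delta time_integralE// => t Tt /=.
  by rewrite [partial s phi _ t]adm_endT ?mulr0.
apply: (half_plane_step (M := M)) => //.
- exact: adm_strip adm s.
- by move=> y t; exact: adm_time adm s y t.
- exact: (adm_bound adm).
- pose b0 := b \_ `]0, T[.
  have mb0 : measurable_fun [set: R] b0.
    apply/(measurable_restrictT _ _).1 => //; apply/measurable_EFinP.
    exact: measurable_int (bL _ T0).
  have mH : measurable (@half_plane R) by exact: measurableX.
  apply: (@eq_measurable_fun _ _ _ _ _ (fun p : R * R =>
      b0 p.2 * rhohat p.1 p.2 * G (u p.1 p.2) * partial s phi p.1 p.2)).
    move=> [y t] _ /=; rewrite /b0 patchE mem_setE in_itv/=.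
    by case: ifPn => // /negP tT; rewrite (adm_time adm) ?mulr0.
  apply: measurable_funM; last first.
    apply: measurable_funTS; exact: continuous_measurable2 (adm_strip adm s).1.
  apply: measurable_funM; last exact: (measurableT_comp mG).
  apply: measurable_funM => //; apply: measurable_funTS.
  exact: (measurableT_comp mb0 measurable_snd).
- by move=> y t t0 yx /=; rewrite -(mulrA (b t)) jump.
Qed.

Lemma adm_left_mass_L1loc x : cont0 x ->
  L1loc (fun t => left_mass (dt phi) (x t) t).
Proof.
move=> xc; apply: cont0_L1loc.
apply: (left_mass_continuous Kge0 (adm_strip adm [:: true]) (adm_dt adm [:: true])
  (adm_bound adm (_ : size [:: true] <= 2)%N) (adm_bound adm (_ : size [:: true; true] <= 2)%N)) => //.
Qed.

Lemma adm_left_mass_cont0 x : cont0 x ->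
  cont0 (fun t => left_mass phi (x t) t).
Proof.
move=> xc.
apply: (left_mass_continuous Kge0 (adm_strip adm [::]) (adm_dt adm [::])
  (adm_bound adm (_ : size [::] <= 2)%N) (adm_bound adm (_ : size [:: true] <= 2)%N)) => //.
Qed.

End balance.

Lemma primitive_damping (sigma : R -> R) : L1loc sigma ->
  primitive (damping sigma) (fun t => - (sigma t * damping sigma t)).
Proof.
move=> sL; apply: (@eq_primitive _ _ (fun t => damping sigma t * (- 1 * sigma t))).
  by move=> t; ring.
rewrite (_ : damping sigma = fun t => expR (- 1 * \int[mu]_(s in `[0, t]) sigma s)).
  exact/primitive_expR/primitiveZ/primitive_int.
by apply/funext => t; rewrite /damping mulN1r.
Qed.

Lemma primitive_damped (alpha sigma : R -> R) : L1loc alpha -> L1loc sigma ->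
  primitive (damped_integral alpha sigma) (fun t => alpha t * damping sigma t).
Proof.
move=> aL sL; apply: primitive_int; apply: L1locM => //.
exact: (primitive_cont0 (primitive_damping sL)).
Qed.

Section shock_equations.
Variables (alpha sigma : R -> R) (rhom rhop um up : R).
Hypotheses (aL : L1loc alpha) (sL : L1loc sigma).
Variables (x v w ud : R -> R).
Hypothesis xv : primitive x v.
Let rho := shock_rhohat rhom rhop x.
Let u := shock_u sigma um up x ud.
Hypothesis mrho : measurable_fun (@half_plane R) (fun p : R * R => rho p.1 p.2).
Hypothesis mu_ : measurable_fun (@half_plane R) (fun p : R * R => u p.1 p.2).
Let E := damping sigma.
Let a := rhop - rhom.
Let b := rhom * um - rhop * up.
Let e := rhom * um ^+ 2 - rhop * up ^+ 2.
Let Ec : cont0 E. Proof. exact: (primitive_cont0 (primitive_damping sL)). Qed.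
Let xc : cont0 x. Proof. exact: (primitive_cont0 xv). Qed.

(** Integrating by parts in time along the curve turns the first balance law
    into a balance of the defect of the Rankine-Hugoniot relation with the mass
    carried by the curve. *)
Lemma weak_mass phi : test_function phi ->
  L1loc w -> L1loc (fun t => alpha t * w t * ud t) ->
  pairing rho u x w ud (fun=> 1) (fun=> 1) (dt phi) +
  pairing rho u x w ud alpha id (dx phi) =
  \int[mu]_(t in `]0, +oo[) ((a * v t + b * (alpha t * E t)) * phi (x t) t +
    (w t * dt phi (x t) t + alpha t * w t * ud t * dx phi (x t) t)).
Proof.
move=> tf wL awL; have [K [T [M [K0 T0 adm]]]] := test_function_admissible tf.
have fc : cont0 (fun t => phi (x t) t) := adm_cont0 (s := [::]) adm xc.
have ftc : cont0 (fun t => dt phi (x t) t) := adm_cont0 (s := [:: true]) adm xc.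
have fxc : cont0 (fun t => dx phi (x t) t) := adm_cont0 (s := [:: false]) adm xc.
have Ltot : primitive (fun=> K) (fun=> 0) := primitive_cst K.
have phiK t : phi K t = 0 by apply: (adm_strip adm [::]).2; rewrite gtr0_norm.
rewrite (pairing_step K0 T0 adm (Am := fun=> rhom) (Ap := fun=> rhop) (s := [:: true]) w ud _ xc)//; last first.
- by move=> y t t0 yx; rewrite mulr1 /rho /shock_rhohat.
- exact: cont0_cst.
- exact: cont0_cst.
- exact: L1loc_cst.
rewrite (pairing_step K0 T0 adm (Am := fun t => rhom * um * E t) (Ap := fun t => rhop * up * E t) (s := [:: false]) w ud _ xc)//; last first.
- move=> y t t0 /eqP yx; rewrite /rho /shock_rhohat /u /shock_u (negbTE yx).
  by case: ifP => _; rewrite mulrA.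
- by apply: cont0M => //; exact: cont0_cst.
- by apply: cont0M => //; exact: cont0_cst.
rewrite (time_integralE (T := T)); last first.
  move=> t Tt; rewrite [phi _ t](adm_endT adm [::])//.
  rewrite [dt _ _ t](adm_endT adm [:: true])//.
  by rewrite [dx _ _ t](adm_endT adm [:: false])// !mulr0 !addr0.
have lx : L1loc (fun t => left_mass (dt phi) (x t) t) := adm_left_mass_L1loc K0 adm xc.
have lK : L1loc (fun t => left_mass (dt phi) K t) := adm_left_mass_L1loc K0 adm (primitive_cont0 Ltot).
have fv : L1loc (fun t => phi (x t) t * v t) by apply: L1locMl => //; case: xv.
have fE : L1loc (fun t => alpha t * E t * phi (x t) t) by apply: L1locM => //; exact: L1locM.
have wft := L1locM wL ftc; have wfx := L1locM awL fxc.
have := left_mass_identity K0 T0 adm xv (primitive_cst 1).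
rewrite (@time_integral_linear _ T0 ([:: (1, fun t => phi (x t) t * v t);
  (1, fun t => left_mass (dt phi) (x t) t)]))/=; [|by []|by move=> t; ring].
have := left_mass_identity K0 T0 adm Ltot (primitive_cst 1).
rewrite (@time_integral_linear _ T0 ([:: (1, left_mass (dt phi) K)]))/=; [|by []|by move=> t; ring].
rewrite [X in _ -> _ -> X + _ + _ = _](@time_integral_linear _ T0 ([:: (rhom - rhop, fun t => left_mass (dt phi) (x t) t);
  (rhop, left_mass (dt phi) K)]))/=; [|by []|by move=> t; ring].
rewrite [X in _ -> _ -> _ + X + _ = _](@time_integral_linear _ T0 ([:: (1, fun t => w t * dt phi (x t) t)]))/=;
  [|by []|by move=> t; ring].
rewrite [X in _ -> _ -> _ + (X + _) = _](@time_integral_linear _ T0 ([:: (b, fun t => alpha t * E t * phi (x t) t)]))/=;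
  [|by []|]; last first.
  move=> t; rewrite !(adm_left_mass_dx K0 adm) [phi K t]phiK.
  by rewrite /b; ring.
rewrite [in X in _ -> _ -> _ = X](@time_integral_linear _ T0 ([:: (a, fun t => phi (x t) t * v t);
  (b, fun t => alpha t * E t * phi (x t) t); (1, fun t => w t * dt phi (x t) t);
  (1, fun t => alpha t * w t * ud t * dx phi (x t) t)]))/=; [|by []|by move=> t; ring].
do 6!move: (time_integral T _) => ?.
rewrite !mul1r !addr0 => -> /eqP; rewrite addr_eq0 => /eqP ->; rewrite /a; ring.
Qed.

(** The second balance law, likewise; the damping of the regular part cancels
    the corresponding part of the source. *)
Lemma weak_momentum phi : test_function phi ->
  L1loc (fun t => w t * ud t) -> L1loc (fun t => alpha t * w t * ud t ^+ 2) ->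
  L1loc (fun t => sigma t * w t * ud t) ->
  pairing rho u x w ud (fun=> 1) id (dt phi) +
  pairing rho u x w ud alpha (fun z => z ^+ 2) (dx phi) -
  pairing rho u x w ud sigma id phi =
  \int[mu]_(t in `]0, +oo[) ((- b * E t * v t + e * (alpha t * E t ^+ 2)) * phi (x t) t +
    (w t * ud t * dt phi (x t) t + alpha t * w t * ud t ^+ 2 * dx phi (x t) t
     - sigma t * w t * ud t * phi (x t) t)).
Proof.
move=> tf wL awL swL; have [K [T [M [K0 T0 adm]]]] := test_function_admissible tf.
have fc : cont0 (fun t => phi (x t) t) := adm_cont0 (s := [::]) adm xc.
have ftc : cont0 (fun t => dt phi (x t) t) := adm_cont0 (s := [:: true]) adm xc.
have fxc : cont0 (fun t => dx phi (x t) t) := adm_cont0 (s := [:: false]) adm xc.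
have Ltot : primitive (fun=> K) (fun=> 0) := primitive_cst K.
have phiK t : phi K t = 0 by apply: (adm_strip adm [::]).2; rewrite gtr0_norm.
have EL := primitive_damping sL.
have jump c d (y t : R) : 0 < t -> y <> x t ->
    (if y < x t then c else d) * u y t = if y < x t then c * um * E t else d * up * E t.
  move=> t0 /eqP yx; rewrite /u /shock_u (negbTE yx).
  by case: ifP => _; rewrite mulrA.
rewrite (pairing_step K0 T0 adm (Am := fun t => rhom * um * E t) (Ap := fun t => rhop * up * E t) (s := [:: true]) w ud _ xc)//; last first.
- by move=> y t t0 yx; exact: jump.
- by apply: cont0M => //; exact: cont0_cst.
- by apply: cont0M => //; exact: cont0_cst.
- exact: L1loc_cst.
rewrite (pairing_step K0 T0 adm (Am := fun t => rhom * um ^+ 2 * (E t * E t)) (Ap := fun t => rhop * up ^+ 2 * (E t * E t)) (s := [:: false]) w ud _ xc)//; last first.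
- move=> y t t0 yx; rewrite expr2 mulrA jump// /u /shock_u; move/eqP: yx => yx.
  rewrite (negbTE yx); case: ifP => _; rewrite /E; ring.
- by apply: cont0M; [exact: cont0_cst|exact: cont0M].
- by apply: cont0M; [exact: cont0_cst|exact: cont0M].
rewrite -[X in pairing _ _ _ _ _ sigma _ X]/(partial [::] phi).
rewrite (pairing_step K0 T0 adm (Am := fun t => rhom * um * E t) (Ap := fun t => rhop * up * E t) (s := [::]) w ud _ xc)//; last first.
- by move=> y t t0 yx; exact: jump.
- by apply: cont0M => //; exact: cont0_cst.
- by apply: cont0M => //; exact: cont0_cst.
rewrite (time_integralE (T := T)); last first.
  move=> t Tt; rewrite [phi _ t](adm_endT adm [::])//.
  rewrite [dt _ _ t](adm_endT adm [:: true])//.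
  by rewrite [dx _ _ t](adm_endT adm [:: false])// !mulr0 !(addr0, subr0).
have lx : L1loc (fun t => left_mass (dt phi) (x t) t) := adm_left_mass_L1loc K0 adm xc.
have lK : L1loc (fun t => left_mass (dt phi) K t) := adm_left_mass_L1loc K0 adm (primitive_cont0 Ltot).
have Elx := L1locMl Ec lx; have ElK := L1locMl Ec lK.
have sEc : L1loc (fun t => sigma t * E t) by exact: L1locM.
have sx := L1locM sEc (adm_left_mass_cont0 K0 adm xc).
have sK := L1locM sEc (adm_left_mass_cont0 K0 adm (primitive_cont0 Ltot)).
have fv : L1loc (fun t => E t * (phi (x t) t * v t)).
  by apply: L1locMl => //; apply: L1locMl => //; case: xv.
have fE : L1loc (fun t => alpha t * (E t * E t) * phi (x t) t).
  by apply: L1locM => //; apply: L1locM => //; exact: cont0M.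
have wft := L1locM wL ftc; have wfx := L1locM awL fxc; have swf := L1locM swL fc.
have := left_mass_identity K0 T0 adm xv EL.
rewrite (@time_integral_linear _ T0 ([:: (1, fun t => E t * (phi (x t) t * v t));
  (1, fun t => E t * left_mass (dt phi) (x t) t);
  (-1, fun t => sigma t * E t * left_mass phi (x t) t)]))/=; [|by []|by move=> t; rewrite /E; ring].
have := left_mass_identity K0 T0 adm Ltot EL.
rewrite (@time_integral_linear _ T0 ([:: (1, fun t => E t * left_mass (dt phi) K t);
  (-1, fun t => sigma t * E t * left_mass phi K t)]))/=; [|by []|by move=> t; rewrite /E; ring].
rewrite [X in _ -> _ -> X + _ + _ - _ = _](@time_integral_linear _ T0 ([:: (b, fun t => E t * left_mass (dt phi) (x t) t);
  (rhop * up, fun t => E t * left_mass (dt phi) K t)]))/=; [|by []|by move=> t; rewrite /b; ring].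
rewrite [X in _ -> _ -> _ + X + _ - _ = _](@time_integral_linear _ T0 ([:: (1, fun t => w t * ud t * dt phi (x t) t)]))/=;
  [|by []|by move=> t; ring].
rewrite [X in _ -> _ -> _ + (X + _) - _ = _](@time_integral_linear _ T0 ([:: (e, fun t => alpha t * (E t * E t) * phi (x t) t)]))/=;
  [|by []|]; last first.
  move=> t; rewrite !(adm_left_mass_dx K0 adm) [phi K t]phiK.
  by rewrite /e; ring.
rewrite [X in _ -> _ -> _ - (X + _) = _](@time_integral_linear _ T0 ([:: (b, fun t => sigma t * E t * left_mass phi (x t) t);
  (rhop * up, fun t => sigma t * E t * left_mass phi K t)]))/=; [|by []|by move=> t; rewrite /b; ring].
rewrite [in X in _ -> _ -> _ = X](@time_integral_linear _ T0 ([:: (- b, fun t => E t * (phi (x t) t * v t));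
  (e, fun t => alpha t * (E t * E t) * phi (x t) t); (1, fun t => w t * ud t * dt phi (x t) t);
  (1, fun t => alpha t * w t * ud t ^+ 2 * dx phi (x t) t);
  (-1, fun t => sigma t * w t * ud t * phi (x t) t)]))/=; [|by []|by move=> t; ring].
do 9!move: (time_integral T _) => ?.
rewrite !mulN1r !mul1r !addr0 => /eqP; rewrite subr_eq0 => /eqP ->.
by move=> /eqP; rewrite addr_eq0 => /eqP ->; ring.
Qed.

End shock_equations.

End weak_equations.


(** * Algebra of the shock speed *)

Section speed.
Context {R : realType}.
Variables (rhom rhop um up : R).
Hypotheses (rhom_gt0 : 0 < rhom) (rhop_gt0 : 0 < rhop).
Let c := shock_speed rhom rhop um up.
Let p := Num.sqrt rhom.
Let q := Num.sqrt rhop.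
Let p0 : 0 < p. Proof. by rewrite sqrtr_gt0. Qed.
Let q0 : 0 < q. Proof. by rewrite sqrtr_gt0. Qed.
Let pE : rhom = p ^+ 2. Proof. by rewrite sqr_sqrtr// ltW. Qed.
Let qE : rhop = q ^+ 2. Proof. by rewrite sqr_sqrtr// ltW. Qed.

Lemma shock_speedE : c = (p * um + q * up) / (p + q).
Proof.
rewrite /c /shock_speed; case: eqP => // e; rewrite /q -e -/p.
by field; rewrite gt_eqF//= addr_gt0.
Qed.

(** The growth rate of the weight with respect to [damped_integral]. *)
Definition weight_rate : R :=
  (if rhom == rhop then rhom else Num.sqrt (rhom * rhop)) * (um - up).

Lemma weight_rateE : weight_rate = p * q * (um - up).
Proof.
rewrite /weight_rate; case: eqP => [e|_]; last by rewrite sqrtrM ?ltW.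
by rewrite /q -e -/p -expr2 -pE.
Qed.

(** Rankine-Hugoniot relation for the mass: the shock collects what the jump of
    the flux brings in. *)
Lemma shock_speed_mass :
  weight_rate = (rhop - rhom) * c + (rhom * um - rhop * up).
Proof.
rewrite weight_rateE shock_speedE pE qE; field.
by rewrite gt_eqF// addr_gt0.
Qed.

(** Rankine-Hugoniot relation for the momentum. *)
Lemma shock_speed_momentum :
  weight_rate * c = rhom * um ^+ 2 - rhop * up ^+ 2 - (rhom * um - rhop * up) * c.
Proof.
rewrite weight_rateE shock_speedE pE qE; field.
by rewrite gt_eqF// addr_gt0.
Qed.

Hypothesis um_gt_up : up < um.

Lemma weight_rate_gt0 : 0 < weight_rate.
Proof. by rewrite weight_rateE !mulr_gt0// subr_gt0. Qed.

Lemma shock_speed_between : up < c < um.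
Proof.
have pq : 0 < p + q by exact: addr_gt0.
rewrite shock_speedE ltr_pdivlMr// ltr_pdivrMr//.
by rewrite !mulrDr !(mulrC _ p) !(mulrC _ q) ltrD2r ltrD2l !ltr_pM2l// um_gt_up.
Qed.

(** The characteristic quadratic is a difference of squares, so that entropy
    selects one of its two roots. *)
Lemma shock_speed_unique (s : R) :
  (rhop - rhom) * s ^+ 2 + (rhom * um - rhop * up) * s *+ 2 =
    rhom * um ^+ 2 - rhop * up ^+ 2 ->
  up < s -> s < um -> s = c.
Proof.
move=> Q us su.
have : (q * (s - up)) ^+ 2 = (p * (um - s)) ^+ 2.
  by rewrite !exprMn -pE -qE; move: Q; rewrite mulr2n; lra.
move/eqP; rewrite eqrXn2 ?mulr_ge0 ?subr_ge0 ?ltW// => /eqP E.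
have pq : p + q != 0 by rewrite gt_eqF// addr_gt0.
by apply: (mulIf pq); rewrite shock_speedE divfK//; lra.
Qed.

End speed.

(** * Initial traces *)

Section traces.
Context {R : realType}.
Notation mu := (@lebesgue_measure R).
Implicit Types (f g x v w : R -> R) (psi : R -> R).

Lemma test_function1_cc psi : test_function1 psi -> continuous psi /\
  exists2 K : R, 0 < K & forall y, K <= `|y| -> psi y = 0.
Proof.
move=> [sm cs]; split.
  by move=> z; apply/differentiable_continuous/derivable1_diffP; exact: (sm 0%N z).
have [K K0 SK] := ex_strict_bound_gt0 (compact_bounded cs).
exists K => // y Ky; apply: contrapT => /eqP py.
by have := SK y (@subset_closure _ [set x | psi x != 0] y py) => /=; rewrite ltNge Ky.
Qed.

Definition lower_mass psi (z : R) := \int[mu]_(y in `]-oo, z]) psi y.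

Lemma strip_of_cc psi (K : R) : continuous psi -> (forall y, K <= `|y| -> psi y = 0) ->
  strip K (fun y _ : R => psi y).
Proof.
move=> cp p0; split=> [p|y _]; last exact: p0.
by apply: (@continuous_comp _ _ _ fst psi); [exact: cvg_fst|exact: cp].
Qed.

Lemma lower_mass_derive psi (K z : R) : continuous psi ->
  (forall y, K <= `|y| -> psi y = 0) -> is_derive z 1 (lower_mass psi) (psi z).
Proof. by move=> cp p0; exact: (left_mass_derive z 0 (strip_of_cc cp p0)). Qed.

Lemma lower_mass_continuous psi (K : R) : continuous psi ->
  (forall y, K <= `|y| -> psi y = 0) -> continuous (lower_mass psi).
Proof.
move=> cp p0 z; apply/differentiable_continuous/derivable1_diffP.
by case: (lower_mass_derive z cp p0).
Qed.

Lemma cont0_cvg0 g : cont0 g -> g t @[t --> 0^'+] --> g 0.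
Proof.
move=> gc; apply/cvgrPdist_lt => e e0; have [d d0 Hd] := cont0_eps gc (lexx 0) e0.
near=> t; rewrite distrC; apply: Hd.
  by apply: ltW; near: t; exact: nbhs_right_gt.
rewrite subr0 gtr0_norm; first by near: t; exact: nbhs_right_lt.
by near: t; exact: nbhs_right_gt.
Unshelve. all: by end_near. Qed.

Lemma cvg_right_eq (f g : R -> R) (l : R) : (forall t, 0 < t -> f t = g t) ->
  g t @[t --> 0^'+] --> l -> f t @[t --> 0^'+] --> l.
Proof.
move=> fg; apply: cvg_trans; apply: near_eq_cvg; near=> t; apply/esym/fg.
by near: t; exact: nbhs_right_gt.
Unshelve. all: by end_near. Qed.

Lemma Rintegral_except f g (z : R) : mu.-integrable [set: R] (EFin \o g) ->
  (forall y, y <> z -> f y = g y) -> \int[mu]_y f y = \int[mu]_y g y.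
Proof.
move=> gi fg.
have -> : f = fun y => g y + (f z - g z) * \1_[set z] y.
  apply/funext => y; rewrite indicE; have [->|/eqP yz] := eqVneq y z.
    by rewrite mem_set//= mulr1 addrC subrK.
  by rewrite memNset//= mulr0 addr0 fg.
have zi : mu.-integrable [set: R] (EFin \o \1_[set z]).
  by rewrite -set_itv1; exact: integrable_indic_itv.
rewrite RintegralD//; last exact: (integrableZl _ _ zi).
rewrite RintegralZl// [X in _ * X](_ : _ = 0) ?mulr0 ?addr0//.
by rewrite /Rintegral integral_indic//= setIT lebesgue_measure_set1.
Qed.

Section shock_traces.
Variables (sigma : R -> R) (rhom rhop um up : R) (x v ud psi : R -> R) (K : R).
Hypotheses (xv : primitive x v) (sL : L1loc sigma) (K0 : 0 < K).
Hypotheses (cp : continuous psi) (p0 : forall y, K <= `|y| -> psi y = 0).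
Let rho := shock_rhohat rhom rhop x.
Let u := shock_u sigma um up x ud.
Let S := lower_mass psi.
Let total := \int[mu]_y psi y.
Let ip : mu.-integrable [set: R] (EFin \o psi). Proof. exact: cc_integrable cp p0. Qed.
Let Sx : cont0 (fun t => S (x t)).
Proof.
move=> t; apply: continuous_comp; first exact: (primitive_cont0 xv).
exact: (lower_mass_continuous cp p0).
Qed.

Lemma shock_mass_trace :
  \int[mu]_y (rho y t * psi y) @[t --> 0^'+] -->
  rhom * S (x 0) + rhop * (total - S (x 0)).
Proof.
under eq_fun do rewrite step_integral//.
apply: (@cont0_cvg0 (fun t => rhom * S (x t) + rhop * (total - S (x t)))) => t.
apply: cvgD; first by apply: cvgM; [exact: cvg_cst|exact: Sx].
apply: cvgM; first exact: cvg_cst.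
by apply: cvgB; [exact: cvg_cst|exact: Sx].
Qed.

(** Off a single point the integrand is again a step times [psi]. *)
Lemma shock_momentum_trace :
  \int[mu]_y (rho y t * u y t * psi y) @[t --> 0^'+] -->
  rhom * um * S (x 0) + rhop * up * (total - S (x 0)).
Proof.
have Ec := primitive_cont0 (primitive_damping sL).
have E0 : damping sigma 0 = 1 by rewrite /damping set_itv1 Rintegral_set1 oppr0 expR0.
have -> : rhom * um * S (x 0) + rhop * up * (total - S (x 0)) =
    rhom * um * damping sigma 0 * S (x 0) + rhop * up * damping sigma 0 * (total - S (x 0)).
  by rewrite E0 !mulr1.
apply: (@cvg_right_eq _ (fun t => rhom * um * damping sigma t * S (x t) +
    rhop * up * damping sigma t * (total - S (x t)))).
  move=> t t0; rewrite -step_integral//; apply: (@Rintegral_except _ _ (x t)).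
    exact: step_integrable.
  move=> y /eqP yx; rewrite /rho /shock_rhohat /u /shock_u (negbTE yx).
  by case: ifP => _; rewrite mulrA.
apply: (@cont0_cvg0 (fun t => rhom * um * damping sigma t * S (x t) +
    rhop * up * damping sigma t * (total - S (x t)))).
move=> t; apply: cvgD; (apply: cvgM; [apply: cvgM; [exact: cvg_cst|exact: Ec]|]).
  exact: Sx.
by apply: cvgB; [exact: cvg_cst|exact: Sx].
Qed.

Lemma riemann_mass (am ap : R) :
  \int[mu]_y (riemann_datum am ap y * psi y) = am * S 0 + ap * (total - S 0).
Proof. exact: step_integral. Qed.

Lemma riemann_momentum :
  \int[mu]_y (riemann_datum rhom rhop y * riemann_datum um up y * psi y) =
  rhom * um * S 0 + rhop * up * (total - S 0).
Proof.
rewrite -riemann_mass; apply: eq_Rintegral => y _; rewrite /riemann_datum.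
by case: ifP => _.
Qed.

End shock_traces.

End traces.

(** * The explicit delta shock is a solution *)

Section existence.
Context {R : realType}.
Notation mu := (@lebesgue_measure R).
Implicit Types (f g x v w F : R -> R).

(** Lebesgue's differentiation theorem for primitives. *)
Lemma ae_derive_primitive F f : primitive F f ->
  {ae mu, forall t, 0 < t -> derivable F t 1 /\ derive1 F t = f t}.
Proof.
move=> [fL Ff]; apply: (ae_imp _ (ae_lebesgue_pt fL)) => t tleb t0.
have tn : t < (Num.bound t).+1%:R.
  have := archi_boundP (ltW t0); rewrite -natr1; lra.
set n := (Num.bound t).+1%:R in tn *.
pose g := f \_ `]0, n[.
have n0 : 0 < n by lra.
have gi : mu.-integrable `[0, n] (EFin \o g).
  rewrite /g -restrict_EFin; apply/integrable_restrict => //=.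
  by rewrite setIidr ?fL//; exact: subset_itv_oo_cc.
have [|dG G'] := @FTC1_lebesgue_pt _ g (BLeft 0) t n tn gi _ (tleb _).
  by first [exact: t0|exact: (ltW t0)|by rewrite lte_fin|by rewrite (@lte_fin R) ltW].
have E : {near t, (fun y => F 0 + \int[mu]_(s in `[0, y]) g s) =1 F}.
  near=> y.
  have y0 : 0 < y by near: y; exact: lt_nbhsr.
  have yn : y < n by near: y; exact: lt_nbhsl.
  rewrite (Ff _ (ltW y0)); congr (_ + _).
  have yi := L1loc_itv y fL (lexx 0).
  rewrite -(Rintegral_itv_obnd_cbnd (r := 0)) -?(Rintegral_itv_obnd_cbnd (r := 0)).
  - apply: eq_Rintegral => s; rewrite inE /g patchE mem_setE/= !in_itv/= => /andP[-> sy].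
    by rewrite (le_lt_trans sy yn).
  - by apply: (@integrableS _ _ _ mu `[0, y]%classic) => //; apply: subset_itvr; rewrite bnd_simp.
  - apply: (@integrableS _ _ _ mu `[0, n]%classic) => //.
    by move=> s; rewrite /= !in_itv/= => /andP[s0 sy]; rewrite ltW//= ltW// (le_lt_trans sy).
have D := is_deriveD (is_derive_cst (F 0) t 1) (DeriveDef dG (erefl _)).
have := near_eq_is_derive E D.
rewrite add0r -derive1E G' => -[dF dFE]; split => //.
by rewrite derive1E dFE /g patchE mem_setE/= in_itv/= t0 tn.
Unshelve. all: by end_near. Qed.

Lemma ae_neq (z : R) : {ae mu, forall t, t <> z}.
Proof.
exists [set z]; split=> [//||t /= /contrapT//].
by rewrite lebesgue_measure_set1.
Qed.

Lemma ae_nonneg_primitive F f : primitive F f ->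
  {ae mu, forall t, 0 <= t -> 0 <= f t} -> forall s t, 0 <= s -> s <= t -> F s <= F t.
Proof.
move=> Ff f0 s t s0 st; rewrite -subr_ge0 (primitiveB Ff s0 st).
have fi := L1loc_itv t Ff.1 s0; have /measurable_EFinP mf := measurable_int _ fi.
rewrite (_ : Rintegral _ _ _ = \int[mu]_(r in `[s, t]) `|f r|).
  by apply: Rintegral_ge0.
congr fine; apply: ae_eq_integral => //; first exact/measurable_EFinP.
  by apply/measurable_EFinP; exact: measurableT_comp.
apply: (ae_imp _ f0) => r f0r; rewrite /= in_itv/= => /andP[sr _].
by rewrite ger0_norm// f0r// (le_trans s0).
Qed.

Lemma damping_le1 (sigma : R -> R) t : L1loc sigma ->
  {ae mu, forall t, 0 <= t -> 0 <= sigma t} -> 0 <= t -> damping sigma t <= 1.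
Proof.
move=> sL s0 t0; rewrite -expR0 ler_expR oppr_le0.
have := ae_nonneg_primitive (primitive_int sL) s0 (lexx 0) t0.
by rewrite set_itv1 Rintegral_set1.
Qed.

Lemma half_plane_measurable : measurable (@half_plane R).
Proof. exact: measurableX. Qed.

Lemma measurable_snd_cont0 g : cont0 g ->
  measurable_fun (@half_plane R) (fun p : R * R => g p.2).
Proof.
move=> gc; have mg := continuous_measurable_fun gc.
apply: (@eq_measurable_fun _ _ _ _ _ (fun p : R * R => g (Num.max 0 p.2))).
  by move=> [y t]; rewrite inE => -[_ /=]; rewrite in_itv/= andbT => t0; rewrite max_r// ltW.
by apply: measurable_funTS; exact: (measurableT_comp mg measurable_snd).
Qed.

Lemma measurable_fst_half : measurable_fun (@half_plane R) (fun p : R * R => p.1).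
Proof. by apply: measurable_funTS; exact: measurable_fst. Qed.

Lemma measurable_jump (b : R * R -> bool) (f g : R * R -> R) :
  measurable_fun (@half_plane R) b -> measurable_fun (@half_plane R) f ->
  measurable_fun (@half_plane R) g ->
  measurable_fun (@half_plane R) (fun p => if b p then f p else g p).
Proof.
move=> mb mf mg; apply: measurable_fun_if => //; first exact: half_plane_measurable.
  exact: measurable_funS half_plane_measurable _ mf.
exact: measurable_funS half_plane_measurable _ mg.
Qed.

Variables (alpha sigma : R -> R) (rhom rhop um up : R).
Hypotheses (aL : L1loc alpha) (sL : L1loc sigma).
Hypothesis sigma_ge0 : {ae mu, forall t, 0 <= t -> 0 <= sigma t}.
Hypotheses (rhom_gt0 : 0 < rhom) (rhop_gt0 : 0 < rhop) (um_gt_up : up < um).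
Let X := shock_curve alpha sigma rhom rhop um up.
Let W := shock_weight alpha sigma rhom rhop um up.
Let U := shock_udelta sigma rhom rhop um up.
Let E := damping sigma.
Let D := damped_integral alpha sigma.
Let c := shock_speed rhom rhop um up.
Let k := weight_rate rhom rhop um up.
Let rho := shock_rhohat rhom rhop X.
Let u := shock_u sigma um up X U.

Let EP : primitive E (fun t => - (sigma t * E t)) := primitive_damping sL.
Let DP : primitive D (fun t => alpha t * E t) := primitive_damped aL sL.
Let XP : primitive X (fun t => c * (alpha t * E t)) := primitiveZ c DP.
Let WP : primitive W (fun t => k * (alpha t * E t)) := primitiveZ k DP.
Let UP : primitive U (fun t => c * - (sigma t * E t)) := primitiveZ c EP.
Let Uc := primitive_cont0 UP.
Let Wc := primitive_cont0 WP.
Let Xc := primitive_cont0 XP.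
Let Ec := primitive_cont0 EP.

Lemma shock_Linfty : Linfty rho /\ Linfty u.
Proof.
have mlt : measurable_fun (@half_plane R) (fun p : R * R => p.1 < X p.2).
  by apply: measurable_fun_ltr; [exact: measurable_fst_half|exact: measurable_snd_cont0].
have meq : measurable_fun (@half_plane R) (fun p : R * R => p.1 == X p.2).
  by apply: measurable_fun_eqr; [exact: measurable_fst_half|exact: measurable_snd_cont0].
have mE (z : R) : measurable_fun (@half_plane R) (fun p : R * R => z * E p.2).
  by apply: measurable_funM => //; exact: measurable_snd_cont0.
split; split.
- by apply: measurable_jump.
- exists (rhom + rhop); apply: aeW => -[y t] _ /=; rewrite /rho /shock_rhohat.
  by case: ifP => _; rewrite ger0_norm ?ltW// ?ltrDl ?ltrDr.
- apply: measurable_jump => //; apply: measurable_jump => //.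
  exact: measurable_snd_cont0.
- exists (`|um| + `|c| + `|up|); apply: aeW => -[y t] [_ /=]; rewrite in_itv/= andbT => t0.
  have E1 : `|E t| <= 1.
    by rewrite ger0_norm ?expR_ge0//; exact: damping_le1 sL sigma_ge0 (ltW t0).
  have h z : `|z * E t| <= `|z| by rewrite normrM ler_piMr.
  have := normr_ge0 um; have := normr_ge0 up; have := normr_ge0 c.
  rewrite /u /shock_u /U /shock_udelta -/c -/E.
  by case: ifP => _; [have := h um|case: ifP => _; [have := h c|have := h up]]; lra.
Qed.

Lemma shock_weights : [/\ L1loc W, L1loc (fun t => W t * U t),
  L1loc (fun t => alpha t * W t * U t), L1loc (fun t => alpha t * W t * U t ^+ 2)
  & L1loc (fun t => sigma t * W t * U t)].
Proof.
have U2 : cont0 (fun t => U t ^+ 2) by exact: cont0M.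
split.
- exact: cont0_L1loc.
- by apply: cont0_L1loc; exact: cont0M.
- by do 2 apply: L1locM => //.
- by do 2 apply: L1locM => //.
- by do 2 apply: L1locM => //.
Qed.

(** The two Rankine-Hugoniot relations turn the balances on the curve into the
    integral of the derivative of [W * phi], respectively of [W * U * phi]. *)
Lemma shock_weak phi : test_function phi ->
  pairing rho u X W U (fun=> 1) (fun=> 1) (dt phi) +
  pairing rho u X W U alpha id (dx phi) = 0 /\
  pairing rho u X W U (fun=> 1) id (dt phi) +
  pairing rho u X W U alpha (fun z => z ^+ 2) (dx phi) =
  pairing rho u X W U sigma id phi.
Proof.
move=> tf; have [[mr _] [mU _]] := shock_Linfty.
have [L1 L2 L3 L4 L5] := shock_weights.
have [K [T [M [K0 T0 adm]]]] := test_function_admissible tf.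
have end_ t : T <= t -> [/\ phi (X t) t = 0, dt phi (X t) t = 0 & dx phi (X t) t = 0].
  move=> Tt; split; [exact: (adm_endT adm [::])|exact: (adm_endT adm [:: true])|
    exact: (adm_endT adm [:: false])].
split.
- rewrite (weak_mass aL sL XP mr mU tf L1 L3) (time_integralE (T := T)); last first.
    by move=> t /end_[-> -> ->]; rewrite !mulr0 !addr0.
  rewrite -[RHS](transport_identity T0 adm XP WP); congr (time_integral T _); apply/funext => t.
  rewrite /U /shock_udelta -/c -/E /k shock_speed_mass// -/c; ring.
- apply/eqP; rewrite -subr_eq0; apply/eqP.
  rewrite (weak_momentum aL sL XP mr mU tf L2 L4 L5) (time_integralE (T := T)); last first.
    by move=> t /end_[-> -> ->]; rewrite !mulr0 !(addr0, subr0).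
  rewrite -[RHS](transport_identity T0 adm XP (primitiveM WP UP)); congr (time_integral T _).
  apply/funext => t; have := shock_speed_momentum um up rhom_gt0 rhop_gt0.
  rewrite -/c -/k => kc.
  rewrite (_ : rhom * um ^+ 2 - rhop * up ^+ 2 = k * c + (rhom * um - rhop * up) * c); last by lra.
  rewrite /U /shock_udelta -/c -/E; ring.
Qed.

Lemma shock_initial : initial_data rho u X W U
  (riemann_datum rhom rhop) (riemann_datum um up).
Proof.
have X0 : X 0 = 0 by rewrite /X /shock_curve /damped_integral set_itv1 Rintegral_set1 mulr0.
have W0 : W 0 = 0 by rewrite /W /shock_weight /damped_integral set_itv1 Rintegral_set1 mulr0.
move=> psi /test_function1_cc[cp [K K0 p0]].
have pX : cont0 (fun t => psi (X t)).
  by move=> t; apply: continuous_comp; [exact: Xc|exact: cp].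
split.
- rewrite (riemann_mass cp p0).
  rewrite (_ : rhom * _ + _ = rhom * lower_mass psi (X 0) +
     rhop * (\int[mu]_y psi y - lower_mass psi (X 0)) + W 0 * psi (X 0)); last first.
    by rewrite X0 W0 mul0r addr0.
  apply: cvgD; first exact: (shock_mass_trace XP cp p0).
  by apply: (@cont0_cvg0 _ (fun t => W t * psi (X t))); exact: cont0M.
- rewrite (riemann_momentum rhom rhop um up cp p0).
  rewrite (_ : rhom * um * _ + _ = rhom * um * lower_mass psi (X 0) +
     rhop * up * (\int[mu]_y psi y - lower_mass psi (X 0)) + W 0 * U 0 * psi (X 0)); last first.
    by rewrite X0 W0 !mul0r addr0.
  apply: cvgD; first exact: (shock_momentum_trace U XP sL cp p0).
  by apply: (@cont0_cvg0 _ (fun t => W t * U t * psi (X t))); do 2 apply: cont0M => //.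
Qed.

Lemma shock_entropy :
  entropy_condition alpha sigma rhom rhop um up X.
Proof.
have /andP[c1 c2] := shock_speed_between rhom_gt0 rhop_gt0 um_gt_up.
apply: (ae_imp2 _ (ae_derive_primitive XP) (ae_neq 0)) => t dX t0 tge at0.
have [|dXt ->] := dX; first by rewrite lt_neqAle tge andbT; apply/eqP/nesym.
split=> //; rewrite /sys_eigenvalue.
have aE : 0 < alpha t * E t by rewrite mulr_gt0// expR_gt0.
rewrite (_ : alpha t * up * _ = up * (alpha t * E t)); last by rewrite /E; ring.
rewrite (_ : alpha t * um * _ = um * (alpha t * E t)); last by rewrite /E; ring.
by rewrite !ltr_pM2r// c1 c2.
Qed.

Lemma shock_existence : riemann_delta_shock alpha sigma rhom rhop um up X W U.
Proof.
split; [|exact: shock_initial|exact: shock_entropy].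
split; [exact: shock_Linfty| | |exact: shock_weights|exact: shock_weak].
- by case: XP => ? ?; exists (fun t => c * (alpha t * E t)).
- by move=> t _; rewrite /shock_u ltxx eqxx.
Qed.

End existence.


(** * Weak primitives and initial values *)

Section weak_primitives.
Context {R : realType}.
Notation mu := (@lebesgue_measure R).
Implicit Types (f g x v w F G : R -> R).

Lemma primitive_ae_unique F f G g : primitive F f -> primitive G g ->
  {ae mu, forall t, 0 < t -> f t = g t} -> F 0 = G 0 ->
  forall t, 0 <= t -> F t = G t.
Proof.
move=> [fL Ff] [gL Gg] fg FG t t0; rewrite Ff// Gg// FG; congr (_ + _).
have fi := L1loc_itv t fL (lexx 0); have gi := L1loc_itv t gL (lexx 0).
congr fine; apply: ae_eq_integral => //.
- exact: measurable_int fi.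
- exact: measurable_int gi.
apply: (ae_imp2 _ fg (ae_neq 0)) => s fgs s0; rewrite /= in_itv/= => /andP[sge _].
by congr EFin; apply: fgs; rewrite lt_neqAle sge andbT; apply/eqP/nesym.
Qed.

Lemma cont0_ae_eq F G : cont0 F -> cont0 G ->
  {ae mu, forall t, 0 < t -> F t = G t} -> forall t, 0 < t -> F t = G t.
Proof.
move=> Fc Gc FG t t0; apply/eqP; rewrite -subr_eq0; apply/negP => /negP n0.
have h0 : 0 < `|F t - G t| by rewrite normr_gt0.
have hc : cont0 (fun s => F s - G s) by move=> s; apply: cvgB; [exact: Fc|exact: Gc].
have [d d0 Hd] := cont0_eps hc (ltW t0) h0.
have [|r /andP[tr rd] Hr] := @ae_exists _ _ t (t + d) _ FG; first by rewrite ltrDl.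
have := Hd r; rewrite Hr ?(lt_trans t0)// subrr sub0r normrN ltxx => Hr'.
have : false by apply: Hr'; [lra|rewrite gtr0_norm; lra].
by [].
Qed.

(** By continuity the primitives agree at every [t > 0]; Lebesgue's theorem then
    identifies the densities. *)
Lemma primitive_ae_density F f G g : primitive F f -> primitive G g ->
  {ae mu, forall t, 0 < t -> F t = G t} -> {ae mu, forall t, 0 < t -> f t = g t}.
Proof.
move=> Ff Gg /(cont0_ae_eq (primitive_cont0 Ff) (primitive_cont0 Gg)) FG.
apply: (ae_imp2 _ (ae_derive_primitive Ff) (ae_derive_primitive Gg)) => t hF hG t0.
have [_ <-] := hF t0; have [_ <-] := hG t0; rewrite !derive1E.
by apply: near_eq_derive; near=> s; apply: FG; near: s; exact: lt_nbhsr.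
Unshelve. all: by end_near. Qed.

Lemma time_test_end (a b : R) eta deta : time_test a b eta deta ->
  [/\ (0 : R) < `|b| + 1, eta 0 = 0 & forall t, `|b| + 1 <= t -> eta t = 0 /\ deta t = 0].
Proof.
move=> [_ _ _ a0 out]; split; first by rewrite ltr_wpDl.
  by case: (out 0) => // /andP[]; rewrite leNgt a0.
by move=> t bt; apply: out => /andP[_]; have := ler_norm b; lra.
Qed.

Lemma time_test_primitive (a b : R) eta deta : time_test a b eta deta -> primitive eta deta.
Proof. by move=> [_ sd H _ _]; apply: primitive_C1 => //; exact: smooth_alg_cont. Qed.

Lemma time_test_cont0 (a b : R) eta deta : time_test a b eta deta -> cont0 eta /\ cont0 deta.
Proof. by move=> [s sd _ _ _]; split; exact/cont_cont0/smooth_alg_cont. Qed.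

Lemma integration_by_parts_test F f (a b : R) eta deta : primitive F f ->
  time_test a b eta deta ->
  \int[mu]_(t in `]0, +oo[) (f t * eta t + F t * deta t) = 0.
Proof.
move=> Ff tt; have [T0 e0 eT] := time_test_end tt.
rewrite (time_integralE (T := `|b| + 1)); last by move=> t /eT[-> ->]; rewrite !mulr0 addr0.
apply: (time_integral_primitive T0 (primitiveM Ff (time_test_primitive tt))).
by rewrite e0 (eT _ (lexx _)).1 !mulr0.
Qed.

Lemma test_integrable f eta (T : R) : 0 < T -> L1loc f -> cont0 eta ->
  (forall t, T <= t -> eta t = 0) ->
  mu.-integrable `]0, +oo[ (EFin \o (fun t => f t * eta t)).
Proof.
move=> T0 fL ec eT; apply: (@integrable_oy _ _ T).
  by move=> t /eT ->; rewrite mulr0.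
exact: (L1locM fL ec).
Qed.

(** du Bois-Reymond: the difference with an actual primitive of [g] has zero weak
    derivative. *)
Lemma weak_primitive f g : L1loc f -> L1loc g ->
  (forall (a b : R) eta deta, time_test a b eta deta ->
    \int[mu]_(t in `]0, +oo[) (g t * eta t + f t * deta t) = 0) ->
  exists C, {ae mu, forall t, 0 < t -> f t = C + \int[mu]_(s in `[0, t]) g s}.
Proof.
move=> fL gL H; have GP := primitive_int gL; set G := fun t => _ in GP.
have GL := cont0_L1loc (primitive_cont0 GP).
have [C HC] : exists C, {ae mu, forall t, 0 < t -> f t - G t = C}.
  apply: weakly_constant; first exact: L1locB.
  move=> a b eta deta tt; have [T0 e0 eT] := time_test_end tt.
  have [ec dc] := time_test_cont0 tt.
  have := H _ _ _ _ tt; have := integration_by_parts_test GP tt.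
  have dT t : `|b| + 1 <= t -> deta t = 0 by move=> /eT[].
  have eT' t : `|b| + 1 <= t -> eta t = 0 by move=> /eT[].
  have i1 := test_integrable T0 gL ec eT'.
  have i2 := test_integrable T0 fL dc dT.
  have i3 := test_integrable T0 GL dc dT.
  rewrite RintegralD// RintegralD//.
  under [in X in _ -> _ -> X = _]eq_Rintegral do rewrite mulrBl.
  rewrite RintegralB//; lra.
exists C; apply: (ae_imp _ HC) => t h t0; have := h t0; rewrite /G; lra.
Qed.

Lemma ae_limit_unique (f g : R -> R) (l l' : R) :
  {ae mu, forall t, 0 < t -> f t = g t} ->
  f t @[t --> 0^'+] --> l -> g t @[t --> 0^'+] --> l' -> l = l'.
Proof.
move=> fg fl gl; apply/eqP; rewrite -subr_eq0 -normr_le0; apply/ler_addgt0Pr => e e0.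
have e2 : 0 < e / 2 by lra.
have /cvgrPdist_le/(_ _ e2) := fl; have /cvgrPdist_le/(_ _ e2) := gl.
move=> [d /= d0 Hd] [d' /= d0' Hd'].
have dd : 0 < Num.min d d' by rewrite lt_min d0.
have [t /andP[t0]] := ae_exists dd fg.
rewrite lt_min => /andP[td td'] /(_ t0) E.
have h1 : `|l' - g t| <= e / 2 by apply: Hd => //=; rewrite sub0r normrN gtr0_norm.
have h2 : `|l - f t| <= e / 2 by apply: Hd' => //=; rewrite sub0r normrN gtr0_norm.
rewrite add0r (_ : l - l' = (l - f t) - (l' - g t)); last by rewrite E; ring.
by rewrite (le_trans (ler_normB _ _))// [leRHS](splitr e) lerD.
Qed.

Lemma test_function1_smooth f (K : R) : smooth_alg f -> (forall y, K < `|y| -> f y = 0) ->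
  test_function1 f.
Proof.
move=> sf f0; split; first by move=> n z; exact: derivable1n_smooth_alg.
have sub : closure [set y | f y != 0] `<=` `[(- K), K]%classic.
  have := compact_closed (@Rhausdorff R) (@segment_compact R (- K) K).
  move=> /closure_id ->; apply: closureS => y /= fy; rewrite in_itv/=.
  by rewrite -ler_norml leNgt; apply: contra fy => /f0 ->.
by apply: (subclosed_compact _ _ sub); [exact: closed_closure|exact: segment_compact].
Qed.

(** A plateau slightly wider than [[-M, M]], so that the derivative vanishes at
    the end points as well. *)
Lemma cutoff (M : R) : 0 <= M -> exists chi dchi K,
  [/\ smooth_alg chi, (forall y : R, is_derive y 1 chi (dchi y)),
   (forall y, `|y| <= M -> chi y = 1 /\ dchi y = 0) &
   forall y, K < `|y| -> chi y = 0].
Proof.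
move=> M0; have [d sd Hd] := smooth_alg_derive (smooth_plateau (M + 1)).
exists (plateau (M + 1)), d, (M + 1 + 2); split => //.
- exact: smooth_plateau.
- move=> y yM; split; first by apply: plateau_in; lra.
  case: (Hd y) => _ <-.
  rewrite (@near_eq_derive _ _ _ (plateau (M + 1)) (cst 1)) ?derive_cst//.
  have yM1 : `|y| < M + 1 by lra.
  have : (fun w : R => `|w|) @ y --> `|y| by exact: norm_continuous.
  move=> /cvgr_lt/(_ _ yM1); apply: filterS => w wM.
  by rewrite plateau_in// ltW.
- by move=> y yK; apply: plateau_out; lra.
Qed.

End weak_primitives.

(** * Uniqueness *)

Section uniqueness.
Context {R : realType}.
Notation mu := (@lebesgue_measure R).
Variables (alpha sigma : R -> R) (rhom rhop um up : R).
Hypotheses (aL : L1loc alpha) (sL : L1loc sigma).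
Hypothesis alpha_ge0 : {ae mu, forall t, 0 <= t -> 0 <= alpha t}.
Hypotheses (rhom_gt0 : 0 < rhom) (rhop_gt0 : 0 < rhop) (um_gt_up : up < um).
Variables (x v w ud : R -> R).
Hypothesis xv : primitive x v.
Let rho := shock_rhohat rhom rhop x.
Let u := shock_u sigma um up x ud.
Hypotheses (mrho : measurable_fun (@half_plane R) (fun p : R * R => rho p.1 p.2))
  (mu_ : measurable_fun (@half_plane R) (fun p : R * R => u p.1 p.2)).
Hypotheses (wL : L1loc w) (mL : L1loc (fun t => w t * ud t))
  (amL : L1loc (fun t => alpha t * w t * ud t))
  (amuL : L1loc (fun t => alpha t * w t * ud t ^+ 2))
  (smL : L1loc (fun t => sigma t * w t * ud t)).
Hypothesis weak1 : forall phi, test_function phi ->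
  pairing rho u x w ud (fun=> 1) (fun=> 1) (dt phi) +
  pairing rho u x w ud alpha id (dx phi) = 0.
Hypothesis weak2 : forall phi, test_function phi ->
  pairing rho u x w ud (fun=> 1) id (dt phi) +
  pairing rho u x w ud alpha (fun z => z ^+ 2) (dx phi) =
  pairing rho u x w ud sigma id phi.
Hypothesis init : initial_data rho u x w ud (riemann_datum rhom rhop) (riemann_datum um up).
Hypothesis entropy : entropy_condition alpha sigma rhom rhop um up x.
Let a := rhop - rhom.
Let b := rhom * um - rhop * up.
Let e := rhom * um ^+ 2 - rhop * up ^+ 2.
Let E := damping sigma.
Let D := damped_integral alpha sigma.
Let c := shock_speed rhom rhop um up.
Let k := weight_rate rhom rhop um up.
Let EP : primitive E (fun t => - (sigma t * E t)) := primitive_damping sL.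
Let DP : primitive D (fun t => alpha t * E t) := primitive_damped aL sL.
Let Ec := primitive_cont0 EP.
Let xc := primitive_cont0 xv.
Let g1 t := a * v t + b * (alpha t * E t).
Let g2 t := - b * E t * v t + e * (alpha t * E t ^+ 2).

(** If the curve started away from the origin, then the initial densities of
    mass and of momentum would both have to be continuous across the gap. *)
Lemma curve_start : x 0 = 0.
Proof.
have [//|x0] := eqVneq (x 0) 0; exfalso.
pose r := `|x 0| / 4; pose m := x 0 / 2.
have r0 : 0 < r by rewrite divr_gt0// normr_gt0.
have mx : `|x 0 - m| = 2 * r.
  rewrite (_ : x 0 - m = x 0 / 2); last by rewrite /m; field.
  by rewrite normrM (gtr0_norm (_ : 0 < 2^-1)) ?invr_gt0// /r; field.
have m0 : `|0 - m| = 2 * r.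
  by rewrite sub0r normrN normrM (gtr0_norm (_ : 0 < 2^-1)) ?invr_gt0// /r; field.
pose psi := spike_at m r.
pose K := `|m| + r.
have p0 y : K < `|y| -> psi y = 0.
  move=> Ky; apply: spike_out => //.
  by have := ler_normB (y - m) (- m); rewrite opprK subrK normrN /K in Ky *; lra.
have spsi : smooth_alg psi by exact: smooth_spike_at.
have cp := smooth_alg_cont spsi.
have p0' y : K + 1 <= `|y| -> psi y = 0 by move=> h; apply: p0; lra.
have [H1 H2] := init (test_function1_smooth spsi p0).
have nearx : \forall t \near 0^'+, psi (x t) = 0.
  have := cont0_cvg0 xc => /cvgrPdist_lt/(_ _ r0); apply: filterS => t h.
  apply: spike_out => //; have := ler_normD (x 0 - x t) (x t - m).
  by rewrite addrA subrK mx; lra.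
have Z1 : w t * psi (x t) @[t --> 0^'+] --> (0 : R).
  apply: cvg_near_cst; apply: filterS nearx => t ->; by rewrite mulr0.
have Z2 : w t * ud t * psi (x t) @[t --> 0^'+] --> (0 : R).
  apply: cvg_near_cst; apply: filterS nearx => t ->; by rewrite mulr0.
set S := lower_mass psi in H1 H2 *; set tot := \int[mu]_y psi y.
have e1 : rhom * S 0 + rhop * (tot - S 0) = rhom * S (x 0) + rhop * (tot - S (x 0)).
  rewrite -[LHS](riemann_mass cp p0') -[RHS]addr0.
  exact: (cvg_unique _ H1 (cvgD (shock_mass_trace xv cp p0') Z1)).
have e2 : rhom * um * S 0 + rhop * up * (tot - S 0) =
    rhom * um * S (x 0) + rhop * up * (tot - S (x 0)).
  rewrite -[LHS](riemann_momentum _ _ _ _ cp p0') -[RHS]addr0.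
  exact: (cvg_unique _ H2 (cvgD (shock_momentum_trace ud xv sL cp p0') Z2)).
have S0 : S 0 - S (x 0) != 0.
  have dS (z : R) : is_derive z 1 (fun z => S z - step_at m r z) (psi z - psi z).
    by apply: is_deriveB; [exact: (lower_mass_derive z cp p0')|exact: is_derive_step_at].
  have := eq_of_derive0 dS (fun w => subrr _) 0 (x 0) => h.
  rewrite (_ : S 0 - S (x 0) = step_at m r 0 - step_at m r (x 0)); last by lra.
  have r1 := @rise1_gt0 R; rewrite /m; have [xp|xn] := ltP 0 (x 0).
    have rE : r = x 0 / 4 by rewrite /r gtr0_norm.
    by rewrite step_left ?step_right ?sub0r ?oppr_eq0 ?gt_eqF//; lra.
  have rE : r = - x 0 / 4 by rewrite /r ler0_norm.
  by rewrite step_right ?step_left ?subr0 ?gt_eqF//; lra.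
have f1 : (rhom - rhop) * (S 0 - S (x 0)) = 0 by lra.
have f2 : (rhom * um - rhop * up) * (S 0 - S (x 0)) = 0 by lra.
move: f1 f2 => /eqP; rewrite mulf_eq0 (negbTE S0) orbF subr_eq0 => /eqP <-.
move=> /eqP; rewrite mulf_eq0 (negbTE S0) orbF -mulrBr mulf_eq0.
by rewrite gt_eqF//= gt_eqF// subr_gt0.
Qed.

(** Separated test functions suffice: [f] will be a cutoff of [1], which sees the
    mass carried by the curve, or of the identity, which sees its moment. *)
Lemma weak_mass_tensor f df s t eta deta (K : R) : smooth_alg f ->
  (forall y : R, is_derive y 1 f (df y)) -> (forall y, K < `|y| -> f y = 0) ->
  time_test s t eta deta ->
  \int[mu]_(t in `]0, +oo[) (g1 t * (f (x t) * eta t) +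
    (w t * (f (x t) * deta t) + alpha t * w t * ud t * (df (x t) * eta t))) = 0.
Proof.
move=> sf fdf f0 [se sd He s0 out].
have tf : test_function (fun y t => f y * eta t).
  by apply: (test_function_tensor sf se s0 f0) => r /out[].
have := weak_mass aL sL xv mrho mu_ tf wL amL.
by rewrite (weak1 tf) (dt_tensor _ He) (dx_tensor _ fdf).
Qed.

Lemma weak_momentum_tensor f df s t eta deta (K : R) : smooth_alg f ->
  (forall y : R, is_derive y 1 f (df y)) -> (forall y, K < `|y| -> f y = 0) ->
  time_test s t eta deta ->
  \int[mu]_(t in `]0, +oo[) (g2 t * (f (x t) * eta t) +
    (w t * ud t * (f (x t) * deta t) + alpha t * w t * ud t ^+ 2 * (df (x t) * eta t)
     - sigma t * w t * ud t * (f (x t) * eta t))) = 0.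
Proof.
move=> sf fdf f0 [se sd He s0 out].
have tf : test_function (fun y t => f y * eta t).
  by apply: (test_function_tensor sf se s0 f0) => r /out[].
have := weak_momentum aL sL xv mrho mu_ tf mL amuL smL.
by rewrite (weak2 tf) subrr (dt_tensor _ He) (dx_tensor _ fdf).
Qed.

Lemma curve_bounded (T : R) : exists2 M : R, 0 <= M & forall t, 0 <= t -> t <= T -> `|x t| <= M.
Proof. by have [M M0 HM] := cont0_bounded T xc; exists M => //; exact: ltW. Qed.

Lemma g1L : L1loc g1.
Proof. by apply: L1locD; apply: L1locZ; [case: xv|case: DP]. Qed.

Lemma g2L : L1loc g2.
Proof.
apply: L1locD.
  under eq_fun do rewrite -mulrA; apply: L1locZ; apply: L1locMl => //; by case: xv.
by apply: L1locZ; apply: L1locM => //; exact: cont0M.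
Qed.

(** The curve is bounded on the support of the time factor, so there a cutoff is
    as good as the constant [1], and only the time derivative is left on the
    weight. *)
Lemma mass_evolution : exists C, {ae mu, forall t, 0 < t -> w t = C + \int[mu]_(s in `[0, t]) g1 s}.
Proof.
apply: weak_primitive => //; first exact: g1L.
move=> s t eta deta tt; have [se sd He s0 out] := tt.
have [M M0 HM] := curve_bounded t.
have [chi [dchi [K [sc Hc cin cout]]]] := cutoff M0.
rewrite -[RHS](weak_mass_tensor sc Hc cout tt); apply: eq_Rintegral => r _.
have [h|/out[-> ->]] := pselect (s <= r <= t); last by rewrite !mulr0 !addr0.
have [|-> ->] := cin (x r); first by apply: HM; lra.
by ring.
Qed.

Lemma moment_evolution : exists C, {ae mu, forall t, 0 < t ->
  w t * x t = C + \int[mu]_(s in `[0, t]) (g1 s * x s + alpha s * w s * ud s)}.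
Proof.
apply: (@weak_primitive _ (fun t => w t * x t)); first exact: L1locM.
  by apply: L1locD => //; apply: L1locM => //; exact: g1L.
move=> s t eta deta tt; have [se sd He s0 out] := tt.
have [M M0 HM] := curve_bounded t.
have [chi [dchi [K [sc Hc cin cout]]]] := cutoff M0.
have sf : smooth_alg (fun y => y * chi y) by apply: sa_mul => //; exact: sa_id.
have Hf (y : R) : is_derive y 1 (fun y => y * chi y) (y * dchi y + chi y).
  apply: (is_derive_eq (is_deriveM (is_derive_id y 1) (Hc y))).
  by rewrite /GRing.scale/= mulr1.
have cout' y : K < `|y| -> y * chi y = 0 by move=> /cout ->; rewrite mulr0.
rewrite -[RHS](weak_mass_tensor sf Hf cout' tt).
apply: eq_Rintegral => r _.
have [h|/out[-> ->]] := pselect (s <= r <= t); last by rewrite !mulr0 !addr0.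
have [|-> ->] := cin (x r); first by apply: HM; lra.
by ring.
Qed.

Lemma momentum_evolution : exists C, {ae mu, forall t, 0 < t ->
  w t * ud t = C + \int[mu]_(s in `[0, t]) (g2 s - sigma s * w s * ud s)}.
Proof.
apply: (@weak_primitive _ (fun t => w t * ud t)) => //.
  by apply: L1locB => //; exact: g2L.
move=> s t eta deta tt; have [se sd He s0 out] := tt.
have [M M0 HM] := curve_bounded t.
have [chi [dchi [K [sc Hc cin cout]]]] := cutoff M0.
rewrite -[RHS](weak_momentum_tensor sc Hc cout tt); apply: eq_Rintegral => r _.
have [h|/out[-> ->]] := pselect (s <= r <= t); last by rewrite !(mulr0, addr0, subr0).
have [|-> ->] := cin (x r); first by apply: HM; lra.
by ring.
Qed.

(** Test functions equal to [1] near the starting point of the curve turn the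
    limits of the singular parts, taken in the sense of distributions, into the
    value at [0] of a continuous representative of the weight. *)
Lemma curve_trace (f F : R -> R) : cont0 F ->
  {ae mu, forall t, 0 < t -> f t = F t} ->
  (forall psi : R -> R, test_function1 psi ->
    f t * psi (x t) @[t --> 0^'+] --> (0 : R)) -> F 0 = 0.
Proof.
move=> Fc fF H.
have [chi [dchi [K [sc Hc cin cout]]]] := cutoff (@ler01 R).
have cx : cont0 (fun t => chi (x t)).
  by move=> t; apply: continuous_comp; [exact: xc|exact: smooth_alg_cont].
have := cont0_cvg0 (cont0M Fc cx); rewrite curve_start (cin 0 _).1 ?normr0 ?mulr1// => H2.
apply: (ae_limit_unique _ H2 (H _ (test_function1_smooth sc cout))).
by apply: (ae_imp _ fF) => t h t0; rewrite h.
Qed.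

(** The regular part alone already attains the initial data, because the curve
    starts at the jump. *)
Lemma mass_trace (psi : R -> R) : test_function1 psi ->
  w t * psi (x t) @[t --> 0^'+] --> (0 : R).
Proof.
move=> tp; have [cp [K K0 p0]] := test_function1_cc tp.
have [H1 _] := init tp; rewrite (riemann_mass cp p0) in H1.
have H2 := shock_mass_trace (rhom := rhom) (rhop := rhop) xv cp p0; rewrite curve_start in H2.
have := cvgB H1 H2; rewrite subrr => H3; apply: (cvg_right_eq _ (H3 _)) => t _.
by rewrite fctE addrAC subrr add0r.
Qed.

Lemma momentum_trace (psi : R -> R) : test_function1 psi ->
  w t * ud t * psi (x t) @[t --> 0^'+] --> (0 : R).
Proof.
move=> tp; have [cp [K K0 p0]] := test_function1_cc tp.
have [_ H1] := init tp; rewrite (riemann_momentum _ _ _ _ cp p0) in H1.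
have H2 := shock_momentum_trace (rhom := rhom) (rhop := rhop) (um := um) (up := up) ud xv sL cp p0.
rewrite curve_start in H2.
have := cvgB H1 H2; rewrite subrr => H3; apply: (cvg_right_eq _ (H3 _)) => t _.
by rewrite fctE addrAC subrr add0r.
Qed.

Let wt t := a * x t + b * D t.
Let mt t := - b * x t + e * D t.
Let wtP : primitive wt g1.
Proof. exact: (primitiveD (primitiveZ a xv) (primitiveZ b DP)). Qed.
Let D0 : D 0 = 0.
Proof. by rewrite /D /damped_integral set_itv1 Rintegral_set1. Qed.

Lemma int00 f : \int[mu]_(s in `[0, 0]) f s = 0 :> R.
Proof. by rewrite set_itv1 Rintegral_set1. Qed.

Lemma mass_explicit : {ae mu, forall t, 0 < t -> w t = wt t}.
Proof.
have [C HC] := mass_evolution; have G1 := primitive_int g1L.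
have C0 : C = 0.
  have P := primitiveD (primitive_cst C) G1.
  by have := curve_trace (primitive_cont0 P) HC mass_trace; rewrite int00 addr0.
apply: (ae_imp _ HC) => t h t0; rewrite (h t0) C0 add0r.
by have [_ ->] := wtP; rewrite ?ltW// /wt curve_start D0 !mulr0 !add0r.
Qed.

(** Dividing by the damping factor absorbs the source term; [Ei] is its
    inverse. *)
Lemma momentum_explicit : {ae mu, forall t, 0 < t -> w t * ud t = E t * mt t}.
Proof.
have [C HC] := momentum_evolution.
have hL : L1loc (fun t => g2 t - sigma t * w t * ud t) by apply: L1locB => //; exact: g2L.
have P := primitiveD (primitive_cst C) (primitive_int hL).
have C0 : C = 0.
  by have := curve_trace (primitive_cont0 P) HC momentum_trace; rewrite int00 addr0.
set M := fun t => _ in P; rewrite -/(M _) in HC.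
pose Ei t := expR (\int[mu]_(s in `[0, t]) sigma s).
have EiP : primitive Ei (fun t => Ei t * sigma t) := primitive_expR (primitive_int sL).
have EEi t : E t * Ei t = 1 by rewrite /E /damping /Ei -expRD addNr expR0.
have MEi := primitiveM P EiP.
have mP : primitive mt (fun t => - b * v t + e * (alpha t * E t)).
  exact: (primitiveD (primitiveZ (- b) xv) (primitiveZ e DP)).
have H : forall t, 0 <= t -> M t * Ei t = mt t.
  apply: (primitive_ae_unique MEi mP).
    apply: (ae_imp _ HC) => t h t0; have <- : w t * ud t = M t := h t0; rewrite add0r /g2.
    have -> : (- b * E t * v t + e * (alpha t * E t ^+ 2) - sigma t * w t * ud t) * Ei t +
       w t * ud t * (Ei t * sigma t) = (E t * Ei t) * (- b * v t + e * (alpha t * E t)) by ring.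
    by rewrite EEi mul1r.
  by rewrite /M /mt int00 C0 curve_start D0 !mulr0 !addr0 mul0r.
apply: (ae_imp _ HC) => t h t0; have -> : w t * ud t = M t := h t0.
by rewrite -H ?ltW// mulrCA EEi mulr1.
Qed.

(** The first moment [w * x] evolves in two ways: as a product of primitives, and
    by the weak equation.  Comparison says that mass moves with the curve. *)
Lemma flux_explicit : {ae mu, forall t, 0 < t -> alpha t * w t * ud t = wt t * v t}.
Proof.
have [C HC] := moment_evolution.
have hL : L1loc (fun t => g1 t * x t + alpha t * w t * ud t).
  by apply: L1locD => //; apply: L1locM => //; exact: g1L.
have P := primitiveD (primitive_cst C) (primitive_int hL).
have Q := primitiveM wtP xv.
have PQ : {ae mu, forall t, 0 < t -> C + \int[mu]_(s in `[0, t]) (g1 s * x s + alpha s * w s * ud s) = wt t * x t}.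
  by apply: (ae_imp2 _ HC mass_explicit) => t h1 h2 t0; rewrite -h1// h2.
apply: (ae_imp _ (primitive_ae_density P Q PQ)) => t h t0; have := h t0; lra.
Qed.

(** The derivative is twice [wt * v - alpha * E * mt], the defect of the relation
    just proved. *)
Lemma conserved_quadratic (t : R) : 0 <= t ->
  a * x t ^+ 2 + b * (x t * D t) *+ 2 = e * D t ^+ 2.
Proof.
move=> t0.
have P : primitive (fun t => a * (x t * x t) + ((2 * b) * (x t * D t) + - e * (D t * D t)))
  (fun t => a * (v t * x t + x t * v t) + ((2 * b) * (v t * D t + x t * (alpha t * E t)) +
     - e * (alpha t * E t * D t + D t * (alpha t * E t)))).
  apply: primitiveD; first exact: (primitiveZ a (primitiveM xv xv)).
  by apply: primitiveD; apply: primitiveZ; exact: primitiveM.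
have Z := primitive_ae_unique P (primitive_cst 0).
have -> : a * x t ^+ 2 + b * (x t * D t) *+ 2 =
    (a * (x t * x t) + ((2 * b) * (x t * D t) + - e * (D t * D t))) + e * D t ^+ 2.
  by rewrite mulr2n; ring.
rewrite Z ?add0r//; last by rewrite curve_start D0; ring.
apply: (ae_imp _ (@filterI _ _ (ae_filter_ringOfSetsType mu) _ _ flux_explicit
  (@filterI _ _ (ae_filter_ringOfSetsType mu) _ _ mass_explicit momentum_explicit))).
move=> s [h1 [h2 h3]] s0; have {}h1 := h1 s0; have {}h2 := h2 s0; have {}h3 := h3 s0.
have : wt s * v s - alpha s * (E s * mt s) = 0 by rewrite -h1 -h3 mulrA subrr.
rewrite /wt /mt => h; rewrite -[RHS](mulr0 2) -h; ring.
Qed.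

(** Where [alpha > 0], the curve moves at velocity [alpha * E * (x / D)], so the
    entropy condition confines the root [x / D] of the quadratic to the interval
    between the two states and it is [c]; where [alpha = 0], nothing moves. *)
Lemma curve_deviation_stationary : {ae mu, forall t, 0 < t ->
  (x t - c * D t) * (v t - c * (alpha t * E t)) = 0}.
Proof.
have H := @filterI _ _ (ae_filter_ringOfSetsType mu) _ _.
apply: (ae_imp _ (H _ _ (H _ _ flux_explicit (H _ _ mass_explicit momentum_explicit))
  (H _ _ (ae_derive_primitive xv) (H _ _ alpha_ge0 entropy)))).
move=> t [[h1 [h2 h3]] [h4 [h5 h6]]] t0.
have {}h1 := h1 t0; have {}h2 := h2 t0; have {}h3 := h3 t0.
have [_ dx_v] := h4 t0; have {}h5 := h5 (ltW t0); have {}h6 := h6 (ltW t0).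
have Q := conserved_quadratic (ltW t0).
have E0 : 0 < E t by exact: expR_gt0.
have [D_0|D_n0] := eqVneq (D t) 0.
  (* No slope is defined here: the quadratic form gives x = 0 if a is nonzero,
     and otherwise the momentum relation does, as b is then nonzero. *)
  suff -> : x t = 0 by rewrite D_0 mulr0 subr0 mul0r.
  have [a0|a_n0] := eqVneq a 0; last first.
    move: Q; rewrite D_0 !mulr0 mul0rn addr0 expr0n mulr0 => /eqP.
    by rewrite mulf_eq0 (negbTE a_n0)/= sqrf_eq0 => /eqP.
  have b0 : b != 0.
    have -> : b = rhom * (um - up) by move: a0; rewrite /a /b => /subr0_eq ->; ring.
    by rewrite gt_eqF// mulr_gt0// subr_gt0.
  have w0 : w t = 0 by rewrite h2 /wt a0 D_0 mul0r mulr0 addr0.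
  move: h3; rewrite w0 mul0r /mt D_0 mulr0 addr0 => /esym/eqP.
  by rewrite !mulf_eq0 oppr_eq0 (gt_eqF E0) (negbTE b0) /= => /eqP.
(* k ^+ 2 is a quarter of the discriminant of the quadratic form. *)
have kae : a * e + b ^+ 2 = k ^+ 2.
  have h := shock_speed_mass um up rhom_gt0 rhop_gt0.
  have h' := shock_speed_momentum um up rhom_gt0 rhop_gt0.
  rewrite -/k -/c -/a -/b in h; rewrite -/k -/c -/b -/e in h'.
  have -> : e = k * c + b * c by lra.
  have -> : k ^+ 2 = k * (a * c + b) by rewrite -h.
  have -> : b ^+ 2 = b * (k - a * c) by rewrite h; ring.
  by rewrite h; ring.
have wt_n0 : wt t != 0.
  rewrite -sqrf_eq0 (_ : wt t ^+ 2 = k ^+ 2 * D t ^+ 2); last first.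
    rewrite -kae mulrDl -mulrA -Q /wt mulr2n; ring.
  by rewrite mulf_neq0// sqrf_eq0 // /k gt_eqF// weight_rate_gt0.
have vE : v t * wt t = alpha t * (E t * mt t) by rewrite mulrC -h1 -h3 mulrA.
have [a0|a_n0] := eqVneq (alpha t) 0.
  move: vE; rewrite a0 mul0r => /eqP; rewrite mulf_eq0 (negbTE wt_n0) orbF => /eqP ->.
  by rewrite mul0r mulr0 subrr mulr0.
have ap : 0 < alpha t by rewrite lt_neqAle eq_sym a_n0.
have [_ /andP[l1 l2]] := h6 ap; rewrite dx_v /sys_eigenvalue in l1 l2.
have aE : 0 < alpha t * E t by rewrite mulr_gt0.
pose s := x t / D t; have xs : x t = s * D t by rewrite /s divfK.
have Qs : a * s ^+ 2 + b * s *+ 2 = e.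
  apply: (mulIf (_ : D t ^+ 2 != 0)); first by rewrite sqrf_eq0.
  by rewrite -Q xs !mulr2n; ring.
have vs : v t = alpha t * E t * s.
  apply: (mulIf wt_n0); rewrite vE /wt /mt xs -Qs mulr2n; ring.
have us : up < s.
  rewrite -(ltr_pM2l aE) -vs (le_lt_trans _ l1)// le_eqVlt; apply/orP; left; apply/eqP.
  by rewrite /E; ring.
have su : s < um.
  rewrite -(ltr_pM2l aE) -vs (lt_le_trans l2)// le_eqVlt; apply/orP; left; apply/eqP.
  by rewrite /E; ring.
have sc : s = c by exact: shock_speed_unique.
by rewrite xs sc subrr mul0r.
Qed.

(** The square of the deviation is a primitive of zero. *)
Lemma curve_unique (t : R) : 0 <= t -> x t = c * D t.
Proof.
move=> t0; have h := primitiveD xv (primitiveZ (- c) DP).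
have Z := primitive_ae_unique (primitiveM h h) (primitive_cst 0).
apply/eqP; rewrite -subr_eq0 -sqrf_eq0 -(Z _ _ _ t0).
- by rewrite mulNr -expr2.
- apply: (ae_imp _ curve_deviation_stationary) => s hs s0; have {}hs := hs s0.
  rewrite (_ : _ + _ = ((x s - c * D s) * (v s - c * (alpha s * E s))) *+ 2); last by rewrite mulr2n; ring.
  by rewrite hs mul0rn.
- by rewrite curve_start D0; ring.
Qed.

Lemma weight_unique : {ae mu, forall t, 0 < t ->
  w t = shock_weight alpha sigma rhom rhop um up t}.
Proof.
apply: (ae_imp _ mass_explicit) => t h t0; rewrite h// /wt curve_unique ?ltW//.
have := shock_speed_mass um up rhom_gt0 rhop_gt0; rewrite -/a -/b -/c => kE.
rewrite (_ : shock_weight _ _ _ _ _ _ _ = k * D t)// /k kE; ring.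
Qed.

Lemma udelta_unique : {ae mu, forall t, 0 < t ->
  shock_weight alpha sigma rhom rhop um up t != 0 ->
  ud t = shock_udelta sigma rhom rhop um up t}.
Proof.
apply: (ae_imp2 _ weight_unique momentum_explicit) => t h1 h2 t0 W0.
apply: (mulfI W0); rewrite -{1}h1// h2// /mt curve_unique ?ltW//.
have := shock_speed_momentum um up rhom_gt0 rhop_gt0; rewrite -/b -/c -/e => kE.
rewrite (_ : shock_weight _ _ _ _ _ _ _ = k * D t)// /shock_udelta -/c -/E.
have -> : k * D t * (c * E t) = k * c * (D t * E t) by ring.
by rewrite /k kE; ring.
Qed.

End uniqueness.

(** * The Riemann problem *)

(* The weights w and w * udelta are L^1 objects, so w and udelta are determined
   almost everywhere, and udelta only where the delta function is present.  If
   alpha > 0 a.e. then the weight is nonzero at every t > 0. *)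
Theorem theorem3p1 (R : realType) (alpha sigma : R -> R)
    (rhom rhop um up : R)
    (alphaL1 : (@lebesgue_measure R).-integrable `[0, +oo[ (EFin \o alpha))
    (alpha_ge0 : {ae @lebesgue_measure R, forall t, 0 <= t -> 0 <= alpha t})
    (sigmaL1 : L1loc sigma)
    (sigma_ge0 : {ae @lebesgue_measure R, forall t, 0 <= t -> 0 <= sigma t})
    (rhom_gt0 : 0 < rhom) (rhop_gt0 : 0 < rhop) (um_gt_up : up < um) :
  let X := shock_curve alpha sigma rhom rhop um up in
  let W := shock_weight alpha sigma rhom rhop um up in
  let U := shock_udelta sigma rhom rhop um up in
  riemann_delta_shock alpha sigma rhom rhop um up X W U /\
  forall x w udelta : R -> R,
    riemann_delta_shock alpha sigma rhom rhop um up x w udelta ->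
    [/\ forall t, 0 <= t -> x t = X t,
        {ae @lebesgue_measure R, forall t, 0 < t -> w t = W t}
      & {ae @lebesgue_measure R,
          forall t, 0 < t -> W t != 0 -> udelta t = U t}].
Proof.
move=> X W U.
have aL : L1loc alpha.
  move=> T T0; apply: integrableS alphaL1 => //.
  by move=> s; rewrite /= !in_itv/= andbT => /andP[/ltW ->].
split; first exact: shock_existence.
move=> x w ud [[[[mr _] [mu_ _]] [v vL xv] _ [wL mL amL amuL smL] weak] init entropy].
have xP : primitive x v by [].
have weak1 phi : test_function phi -> _ := fun h => (weak phi h).1.
have weak2 phi : test_function phi -> _ := fun h => (weak phi h).2.
split.
- exact: (curve_unique aL sigmaL1 alpha_ge0 rhom_gt0 rhop_gt0 um_gt_up xP mr mu_
    wL mL amL amuL smL weak1 weak2 init entropy).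
- exact: (weight_unique aL sigmaL1 alpha_ge0 rhom_gt0 rhop_gt0 um_gt_up xP mr mu_
    wL mL amL amuL smL weak1 weak2 init entropy).
- exact: (udelta_unique aL sigmaL1 alpha_ge0 rhom_gt0 rhop_gt0 um_gt_up xP mr mu_
    wL mL amL amuL smL weak1 weak2 init entropy).
Qed.
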